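(* Let $n\ge 2$ agents communicate over an undirected connected weighted graph with Laplacian $L$. Let $f_1,\dots,f_n:\mathbb{R}^d\to\mathbb{R}$ be differentiable with $\|\nabla f_i(x)-\nabla f_i(y)\|\le L_f\|x-y\|$ for all $x,y\in\mathbb{R}^d$, $i\in[n]$, where $L_f>0$. Let $f=\frac1n\sum_{i=1}^n f_i$, assume that $f^*=\min_{x\in\mathbb{R}^d}f(x)$ is finite, and assume that $f$ satisfies the Polyak–Łojasiewicz condition with constant $\nu>0$: $\frac12\|\nabla f(x)\|^2\ge\nu(f(x)-f^* )$ for all $x\in\mathbb{R}^d$. Let $\mathcal{C}:\mathbb{R}^d\to\mathbb{R}^d$ be a (possibly random) compressor such that, for some real number $p\ge1$ and constant $C\ge0$, $\mathbf{E}_{\mathcal{C}}[\|\mathcal{C}(x)-x\|_p^2]\le C$ for all $x\in\mathbb{R}^d$. Let $\{x_{i,k}\}$ be generated by Algorithm 3 (see context) with $\alpha=\kappa_1\beta$, $\beta>\kappa_2$, $\eta\in(0,\tilde\kappa_3)$ and $s_k=s_0\gamma^k$, where $\kappa_1,\kappa_2,\tilde\kappa_3$ are the positive constants defined in the context, $s_0>0$ is arbitrary and $\gamma\in(0,1)$ is arbitrary. Let $\bar x_k=\frac1n\sum_{i=1}^n x_{i,k}$. Let $\tilde\epsilon$ be any constant in $(0,\min\{\tilde\epsilon_0,1-\gamma^2\})$, with $\tilde\epsilon_0>0$ defined in the context. Then $\tilde\epsilon\in(0,1)$ and, for any $k\in\mathbb{N}_0$, $$\sum_{i=1}^{n}\mathbf{E}_{\mathcal{C}}\big[\|x_{i,k}-\bar{x}_k\|^2+f(\bar{x}_k)-f^*\big]=\mathcal{O}((1-\tilde\epsilon)^{k}),$$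 i.e. the left side is at most a constant independent of $k$ times $(1-\tilde\epsilon)^k$.
   Context: Notation: $\mathbb{N}_0$ is the set of nonnegative integers, $[n]=\{1,\dots,n\}$, $\|\cdot\|_p$ is the $p$-norm and $\|\cdot\|=\|\cdot\|_2$. The graph has symmetric weighted adjacency matrix $A=(a_{ij})$, $a_{ij}\ge0$, $a_{ii}=0$; $(i,j)$ is an edge iff $a_{ij}>0$; $L=(L_{ij})=\mathrm{diag}(\sum_j a_{1j},\dots,\sum_j a_{nj})-A$. $\rho(L)$ is the spectral radius of $L$ and $\rho_2(L)$ its smallest positive eigenvalue. $\mathbf{E}_{\mathcal C}$ is expectation over the internal randomness of the compressor; each application of $\mathcal C$ uses fresh randomness, so the compressor inequality holds conditionally on the past. Algorithm 3: positive parameters $\alpha,\beta,\eta$ and a positive scaling sequence $\{s_k\}$. Initialize with arbitrary (deterministic) $x_{i,0}\in\mathbb{R}^d$, $\hat x_{i,-1}=y_{i,-1}=v_{i,0}=\mathbf 0_d$, $q_{i,0}=\mathcal C(x_{i,0}/s_0)$. For $k=0,1,\dots$ and all $i\in[n]$: $\hat x_{i,k}=\hat x_{i,k-1}+s_kq_{i,k}$; $y_{i,k}=y_{i,k-1}+s_kq_{i,k}-s_k\sum_{j=1}^nL_{ij}q_{j,k}$; $x_{i,k+1}=x_{i,k}-\eta\alpha(\hat x_{i,k}-y_{i,k})-\eta(\beta v_{i,k}+\nabla f_i(x_{i,k}))$; $v_{i,k+1}=v_{i,k}+\eta\beta(\hat x_{i,k}-y_{i,k})$; $q_{i,k+1}=\mathcal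 C((x_{i,k+1}-\hat x_{i,k})/s_{k+1})$. Constants: $\kappa_4>0$ is any constant; $\kappa_1$ is any constant with $\kappa_1\ge\max\{\frac{9+\kappa_4}{2\rho_2(L)},1\}$; $\kappa_5=\max\{\frac{4+5L_f^2}{\kappa_4},\frac{6}{\rho_2(L)}\}$; $\kappa_6=\frac{8(\kappa_1+1)^2L_f^2}{\kappa_5\rho_2(L)}+\frac{4L_f^2}{\rho_2^2(L)}$; $\kappa_2=\max\{\kappa_5,\sqrt{\kappa_6}\}$; $\tilde\kappa_3=\min\{\frac{\epsilon_1}{\tilde\epsilon_2},\frac{\epsilon_3}{\tilde\epsilon_4},\frac{\epsilon_5}{\epsilon_6}\}$, with $\epsilon_1=\frac{\alpha}{2}\rho_2(L)-\frac14(9\beta+4+5L_f^2)$, $\tilde\epsilon_2=3L_f^2+2\beta^2+1+3\alpha^2\rho^2(L)$, $\epsilon_3=\frac{\beta}{2}-3\rho_2^{-1}(L)$, $\tilde\epsilon_4=2\beta^2\rho(L)+\rho_2^{-1}(L)$, $\epsilon_5=\frac18-\frac{(\alpha+\beta)^2L_f^2}{\beta^5\rho_2(L)}-\frac{L_f^2}{2\beta^2\rho_2^2(L)}$, $\epsilon_6=\frac{(\alpha+\beta)L_f^2}{2\beta^3\rho_2(L)}+\frac{3L_f^2}{4}+\frac{L_f^2}{2\beta^2\rho_2^2(L)}+\frac{L_f}{2}$. Further, $\tilde\epsilon_0=\tilde\epsilon_{12}/\epsilon_{11}$ with $\epsilon_{11}=\max\{\frac12+\frac{\alpha}{\beta},\frac{\alpha\rho_2(L)+\beta}{2\alpha\rho_2(L)}\}$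 and $\tilde\epsilon_{12}=\eta\min\{\epsilon_1-\eta\tilde\epsilon_2,\ \epsilon_3-\eta\tilde\epsilon_4,\ \frac{\nu}{2}\}$. *)

(* Defs.v *)
From HB Require Import structures.
From mathcomp Require Import all_boot all_order all_algebra.
From mathcomp Require Import all_classical all_reals all_analysis.
From mathcomp.real_closed Require Import complex.

Set Implicit Arguments.
Unset Strict Implicit.
Unset Printing Implicit Defensive.

Import Order.TTheory GRing.Theory Num.Theory.
Import numFieldNormedType.Exports.

Local Open Scope classical_set_scope.
Local Open Scope ring_scope.

(* Vectors of R^d are rows. The library norm on 'rV[R]_d is the max norm, so
   the p-norms are introduced separately; differentiability, continuity and
   Borel sets do not depend on the choice of norm. *)
Definition pnorm (R : realType) (d : nat) (p : R) (x : 'rV[R]_d) : R :=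
  (\sum_(j < d) `|x 0 j| `^ p) `^ p^-1.

Definition norm2 (R : realType) (d : nat) (x : 'rV[R]_d) : R := pnorm 2 x.

(* The 'D_v f x are junk values where f is not differentiable:
   use together with a differentiability hypothesis. *)
Definition gradient (R : realType) (d : nat) (f : 'rV[R]_d -> R)
    (x : 'rV[R]_d) : 'rV[R]_d :=
  \row_(j < d) 'D_(delta_mx 0 j) f x.

Definition mean (R : realType) (n : nat) (V : lmodType R) (u : 'I_n -> V) : V :=
  n%:R^-1 *: \sum_(i < n) u i.

Definition weighted_adjacency (R : realType) (n : nat) (A : 'M[R]_n) : Prop :=
  [/\ A^T = A, (forall i j, 0 <= A i j) & (forall i, A i i = 0)].

Definition connected_graph (R : realType) (n : nat) (A : 'M[R]_n) : Prop :=
  forall i j : 'I_n, connect [rel i' j' : 'I_n | 0 < A i' j'] i j.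

Definition laplacian (R : realType) (n : nat) (A : 'M[R]_n) : 'M[R]_n :=
  diag_mx (\row_i \sum_(j < n) A i j) - A.

(* Largest modulus of the complex eigenvalues. *)
Definition spectral_radius (R : realType) (n : nat) (M : 'M[R]_n) : R :=
  sup [set r : R | exists2 z : R[i],
         eigenvalue (map_mx (fun a : R => a%:C%C) M) z
         & r = ComplexField.Normc.normc z].

(* A matrix has finitely many eigenvalues, so the infimum is a minimum as soon
   as some eigenvalue is positive (it is 0 otherwise); the Laplacian of a
   connected graph on at least two vertices has a positive eigenvalue. *)
Definition smallest_pos_eigenvalue (R : realType) (n : nat) (M : 'M[R]_n) : R :=
  inf [set a : R | 0 < a /\ eigenvalue M a].

Definition borel_rV (R : realType) (d : nat) :=
  g_sigma_algebraType (@open 'rV[R]_d).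

Definition mutually_independent (R : realType) (dO dT : measure_display)
    (Omega : measurableType dO) (T : measurableType dT)
    (P : probability Omega R) (I : eqType) (X : I -> Omega -> T) : Prop :=
  forall (J : seq I) (B : I -> set T), uniq J ->
    (forall j, j \in J -> measurable (B j)) ->
    P (\bigcap_(j in [set` J]) (X j @^-1` B j)) =
      (\prod_(j <- J) P (X j @^-1` B j))%E.

(* A possibly random compressor is a map Q : T -> R^d -> R^d, measurable
   jointly in the random seed (drawn in T with law PT) and in the argument;
   a deterministic compressor ignores its seed. *)
Definition compressor_measurable (R : realType) (d : nat) (dT : measure_display)
    (T : measurableType dT) (Q : T -> 'rV[R]_d -> 'rV[R]_d) : Prop :=
  measurable_fun [set: T * borel_rV R d]
    (fun z : T * borel_rV R d => Q z.1 z.2 : borel_rV R d).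

Definition compression_error_bounded (R : realType) (d : nat)
    (dT : measure_display) (T : measurableType dT) (PT : probability T R)
    (Q : T -> 'rV[R]_d -> 'rV[R]_d) (p C : R) : Prop :=
  forall x : 'rV[R]_d,
    ('E_PT[(fun t => pnorm p (Q t x - x) ^+ 2)%R] <= C%:E)%E.

(* Each application of the compressor uses a fresh seed: the k-th call made by
   agent i uses the seed xi (k, i). *)
Definition fresh_seeds (R : realType) (n : nat) (dT dO : measure_display)
    (T : measurableType dT) (PT : probability T R)
    (Omega : measurableType dO) (P : probability Omega R)
    (xi : nat * 'I_n -> Omega -> T) : Prop :=
  [/\ (forall a, measurable_fun [set: Omega] (xi a)),
      (forall a B, measurable B -> P (xi a @^-1` B) = PT B)
    & mutually_independent P xi].

(* u_(k-1), with the convention u_(-1) = 0. *)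
Definition prev (V : nmodType) (u : nat -> V) (k : nat) : V :=
  if k is k'.+1 then u k' else 0.

(* One trajectory of the algorithm; cmp k i is the k-th application of the
   compressor by agent i. *)
Record compressed_primal_dual (R : realType) (n d : nat) (L : 'M[R]_n)
    (grad : 'I_n -> 'rV[R]_d -> 'rV[R]_d) (alpha beta eta : R) (s : nat -> R)
    (cmp : nat -> 'I_n -> 'rV[R]_d -> 'rV[R]_d) (x0 : 'I_n -> 'rV[R]_d)
    (x xhat y v q : nat -> 'I_n -> 'rV[R]_d) : Prop := CompressedPrimalDual {
  cpd_x_init : forall i, x 0%N i = x0 i;
  cpd_v_init : forall i, v 0%N i = 0;
  cpd_q_init : forall i, q 0%N i = cmp 0%N i ((s 0%N)^-1 *: x 0%N i);
  cpd_xhat : forall k i, xhat k i = prev (xhat^~ i) k + s k *: q k i;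
  cpd_y : forall k i, y k i =
    prev (y^~ i) k + s k *: q k i - s k *: \sum_(j < n) L i j *: q k j;
  cpd_x : forall k i, x k.+1 i =
    x k i - (eta * alpha) *: (xhat k i - y k i)
          - eta *: (beta *: v k i + grad i (x k i));
  cpd_v : forall k i, v k.+1 i = v k i + (eta * beta) *: (xhat k i - y k i);
  cpd_q : forall k i, q k.+1 i =
    cmp k.+1 i ((s k.+1)^-1 *: (x k.+1 i - xhat k i))
}.

(* In the constants below, rho and rho2 stand for the spectral radius and the
   smallest positive eigenvalue of the Laplacian. *)
Definition kappa5 (R : realType) (kappa4 Lf rho2 : R) : R :=
  Num.max ((4 + 5 * Lf ^+ 2) / kappa4) (6 / rho2).

Definition kappa6 (R : realType) (kappa1 kappa4 Lf rho2 : R) : R :=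
  8 * (kappa1 + 1) ^+ 2 * Lf ^+ 2 / (kappa5 kappa4 Lf rho2 * rho2)
  + 4 * Lf ^+ 2 / rho2 ^+ 2.

Definition kappa2 (R : realType) (kappa1 kappa4 Lf rho2 : R) : R :=
  Num.max (kappa5 kappa4 Lf rho2) (Num.sqrt (kappa6 kappa1 kappa4 Lf rho2)).

Definition eps1 (R : realType) (alpha beta Lf rho2 : R) : R :=
  alpha / 2 * rho2 - 4^-1 * (9 * beta + 4 + 5 * Lf ^+ 2).

Definition teps2 (R : realType) (alpha beta Lf rho : R) : R :=
  3 * Lf ^+ 2 + 2 * beta ^+ 2 + 1 + 3 * alpha ^+ 2 * rho ^+ 2.

Definition eps3 (R : realType) (beta rho2 : R) : R :=
  beta / 2 - 3 * rho2^-1.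

Definition teps4 (R : realType) (beta rho rho2 : R) : R :=
  2 * beta ^+ 2 * rho + rho2^-1.

Definition eps5 (R : realType) (alpha beta Lf rho2 : R) : R :=
  8^-1 - (alpha + beta) ^+ 2 * Lf ^+ 2 / (beta ^+ 5 * rho2)
       - Lf ^+ 2 / (2 * beta ^+ 2 * rho2 ^+ 2).

Definition eps6 (R : realType) (alpha beta Lf rho2 : R) : R :=
  (alpha + beta) * Lf ^+ 2 / (2 * beta ^+ 3 * rho2) + 3 * Lf ^+ 2 / 4
  + Lf ^+ 2 / (2 * beta ^+ 2 * rho2 ^+ 2) + Lf / 2.

Definition tkappa3 (R : realType) (alpha beta Lf rho rho2 : R) : R :=
  Num.min (eps1 alpha beta Lf rho2 / teps2 alpha beta Lf rho)
    (Num.min (eps3 beta rho2 / teps4 beta rho rho2)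
             (eps5 alpha beta Lf rho2 / eps6 alpha beta Lf rho2)).

Definition eps11 (R : realType) (alpha beta rho2 : R) : R :=
  Num.max (2^-1 + alpha / beta) ((alpha * rho2 + beta) / (2 * alpha * rho2)).

Definition teps12 (R : realType) (alpha beta eta nu Lf rho rho2 : R) : R :=
  eta * Num.min (eps1 alpha beta Lf rho2 - eta * teps2 alpha beta Lf rho)
          (Num.min (eps3 beta rho2 - eta * teps4 beta rho rho2) (nu / 2)).

Definition teps0 (R : realType) (alpha beta eta nu Lf rho rho2 : R) : R :=
  teps12 alpha beta eta nu Lf rho rho2 / eps11 alpha beta rho2.

(* Main.v *)
Require Import Defs.
From HB Require Import structures.
From mathcomp Require Import all_boot all_order all_algebra.
From mathcomp Require Import all_classical all_reals all_analysis.
From mathcomp Require Import spectral sesquilinear measurable_realfun ring lra.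
From mathcomp.real_closed Require Import complex.

                                                                                
                                                                               
                                                                           
                                                                                    
                                                             
  
                                                            
                                
  
                                                                                   
                                                                                 
                                                                         
                                                                           
                                                                         
                                                                                  
                                                                     
                                                                             
                                                    

(** Stack the agents' vectors as the rows of a matrix, let [K] remove the column means, and put e_k
    = xhat_k - x_k. Since xhat_k - y_k = L xhat_k, the iteration reads x_{k+1} = x_k - eta (alpha L
    (x_k + e_k) + beta v_k + grad(x_k)), v_{k+1} = v_k + eta beta L (x_k + e_k): a primal-dual
    gradient method perturbed only by e_k.

    When e_k = 0, the weight 1 + alpha / beta cancels the first-order terms in <Kx, L z>, the mean
    makes an inexact gradient step for f, whose gap decays by the Polyak-Lojasiewicz condition, and
    for eta below [tkappa3] the remaining products are absorbed: V shrinks by the factor 1 - [teps0]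
    ([quad_lyap_descent], [gap_step], [lyap_step_exact]).

    The error leaves the mean alone, because the columns of L sum to zero, and shifts the arguments
    of the quadratic part linearly. Spending the slack [teps0] - [teps] in Young's inequality gives
    V_{k+1} <= (1 - teps) V_k + Ce |e_k|^2 on every trajectory ([lyap_step]). Now e_k is s_k times a
    compression error whose second moment is bounded whatever its argument; that argument depends on
    earlier seeds only, so independence gives E|e_k|^2 = O(gamma^(2k))
    ([compression_error_expectation]). *)

Set Implicit Arguments.
Unset Strict Implicit.
Unset Printing Implicit Defensive.

Import Order.TTheory GRing.Theory Num.Theory.
Import numFieldNormedType.Exports.

Local Open Scope classical_set_scope.
Local Open Scope ring_scope.

                              

(** * Frobenius inner product and Young inequalities *)

Section FrobeniusProduct.
Context {R : realFieldType} {m n : nat}.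
Implicit Types (X Y Z : 'M[R]_(m, n)).

(** Serves both for stacks of agents and, with a single row, for R^d, so that the energy estimates
    involve no square roots. *)
Definition ip X Y : R := \tr (X *m Y^T).

Lemma ipE X Y : ip X Y = \sum_i \sum_j X i j * Y i j.
Proof.
rewrite /ip /mxtrace; apply: eq_bigr => i _; rewrite mxE.
by apply: eq_bigr => j _; rewrite mxE.
Qed.

Lemma ipC X Y : ip X Y = ip Y X.
Proof. by rewrite /ip -mxtrace_tr trmx_mul trmxK. Qed.

Lemma ipDl X Y Z : ip (X + Y) Z = ip X Z + ip Y Z.
Proof. by rewrite /ip mulmxDl mxtraceD. Qed.

Lemma ipZl a X Y : ip (a *: X) Y = a * ip X Y.
Proof. by rewrite /ip -scalemxAl mxtraceZ. Qed.

Lemma ipNl X Y : ip (- X) Y = - ip X Y.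
Proof. by rewrite -scaleN1r ipZl mulN1r. Qed.

Lemma ipDr X Y Z : ip Z (X + Y) = ip Z X + ip Z Y.
Proof. by rewrite ipC ipDl !(ipC Z). Qed.

Lemma ipZr a X Y : ip X (a *: Y) = a * ip X Y.
Proof. by rewrite ipC ipZl ipC. Qed.

Lemma ipNr X Y : ip X (- Y) = - ip X Y.
Proof. by rewrite ipC ipNl ipC. Qed.

Lemma ip0l X : ip 0 X = 0.
Proof. by rewrite -(scale0r 0) ipZl mul0r. Qed.

Definition ip_lin := (ipDl, ipDr, ipNl, ipNr, ipZl, ipZr).

Lemma ip_ge0 X : 0 <= ip X X.
Proof. by rewrite ipE; do 2!(apply: sumr_ge0 => ? _); rewrite -expr2 sqr_ge0. Qed.

Lemma ip_eq0 X : ip X X = 0 -> X = 0.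
Proof.
rewrite ipE => /eqP; rewrite psumr_eq0 => [/allP X0|i _]; last first.
  by apply: sumr_ge0 => j _; rewrite -expr2 sqr_ge0.
apply/matrixP => i j; rewrite mxE.
have := X0 i (mem_index_enum _) => /=; rewrite psumr_eq0 => [/allP|k _]; last first.
  by rewrite -expr2 sqr_ge0.
by move=> /(_ j (mem_index_enum _)) /=; rewrite mulf_eq0 orbb => /eqP.
Qed.

(** Expand |t X - Y|^2 >= 0 and divide by t. *)
Lemma ip_young (t : R) X Y : 0 < t ->
  2 * ip X Y <= t * ip X X + t^-1 * ip Y Y.
Proof.
move=> t0; have := ip_ge0 (t *: X - Y); rewrite !ip_lin (ipC Y X) => h.
rewrite -(ler_pM2l t0) mulrDr mulrA (mulrA t t^-1) divff ?gt_eqF//; nra.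
Qed.

End FrobeniusProduct.

Lemma ip_mulmx {R : realFieldType} {m k n : nat} (L : 'M[R]_(m, k))
  (X : 'M[R]_(k, n)) (Y : 'M[R]_(m, n)) : ip (L *m X) Y = ip X (L^T *m Y).
Proof.
by rewrite /ip trmx_mul trmxK -mulmxA mxtrace_mulC mulmxA.
Qed.

(** The same expansion for the semi-inner product <X, L Y>. *)
Lemma ip_young_psd {R : realFieldType} {m n : nat} (L : 'M[R]_m) (t : R)
    (X Y : 'M[R]_(m, n)) : L^T = L -> (forall Z : 'M[R]_(m, n), 0 <= ip Z (L *m Z)) ->
  0 < t -> 2 * ip X (L *m Y) <= t * ip X (L *m X) + t^-1 * ip Y (L *m Y).
Proof.
move=> Lsym Lpos t0; have := Lpos (t *: X - Y).
rewrite mulmxBr -scalemxAr !ip_lin (ipC Y (L *m X)) ip_mulmx Lsym => h.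
rewrite -(ler_pM2l t0) mulrDr mulrA (mulrA t t^-1) divff ?gt_eqF//; nra.
Qed.


(** * The quadratic part of the Lyapunov function *)

Section Lyapunov.
Context {R : realType} {n d : nat}.
Variables (L : 'M[R]_n) (alpha beta rho rho2 : R).
Implicit Types (x z y h : 'M[R]_(n, d)).

                                                                                 
                                                                           
                              
(** Meant for [x] the centred primal stack and [z] the pseudo-inverse of [L] applied to the shifted
    dual variable. The weight 1 + alpha / beta is the one for which the first-order terms in <x, L
    z> cancel along a step. *)
Definition quad_lyap x z : R :=
  2^-1 * ip x x + (1 + alpha / beta) / 2 * ip z (L *m z) + ip x z.

Lemma quad_lyap_le x z : 0 < alpha -> 0 < beta -> 0 < rho2 -> rho2 * ip z z <= ip z (L *m z) ->
  quad_lyap x z <= eps11 alpha beta rho2 * (ip x x + ip z (L *m z)).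
Proof.
move=> a0 beta_gt0 rho2_gt0 zU.
have U0 : 0 <= ip z (L *m z).
  by apply: le_trans zU; rewrite mulr_ge0 ?ip_ge0// ltW.
(* With this parameter |z|^2 / t equals (alpha / beta) rho2 |z|^2, which coercivity bounds by (alpha
   / beta) <z, L z>; the two entries of [eps11] result. *)
have yg := @ip_young _ _ _ (beta / (alpha * rho2)) x z _.
have {}yg := yg (divr_gt0 beta_gt0 (mulr_gt0 a0 rho2_gt0)).
have iE : (beta / (alpha * rho2))^-1 * ip z z <= alpha / beta * ip z (L *m z).
  have -> : (beta / (alpha * rho2))^-1 * ip z z = alpha / beta * (rho2 * ip z z).
    by field; rewrite !gt_eqF.
  by rewrite ler_wpM2l// divr_ge0// ltW.
rewrite mulrDr /quad_lyap.
apply: (@le_trans _ _ ((2^-1 + alpha / beta) * ip z (L *m z)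
   + (alpha * rho2 + beta) / (2 * alpha * rho2) * ip x x)).
  have -> : (alpha * rho2 + beta) / (2 * alpha * rho2) =
            2^-1 + beta / (alpha * rho2) / 2.
    by field; rewrite !gt_eqF.
  lra.
rewrite addrC lerD// ler_wpM2r ?ip_ge0// /eps11 le_max lexx ?orbT//.
Qed.

(** The middle term is at least 2 |z|^2, and Young with t = 1/4 bounds the cross term below by -2
    |z|^2 - |x|^2 / 8; what remains is 1/2 - 1/8 = 3/8. *)
Lemma quad_lyap_ge x z : 0 <= 1 + alpha / beta -> 4 <= (1 + alpha / beta) * rho2 ->
  rho2 * ip z z <= ip z (L *m z) -> 3 / 8 * ip x x <= quad_lyap x z.
Proof.
move=> c0 c4 zU.
have := @ip_young _ _ _ (4^-1) (- x) z ltac:(lra); rewrite invrK !ip_lin.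
have h1 := ler_wpM2l c0 zU.
have h2 := ler_wpM2r (ip_ge0 z) c4.
rewrite /quad_lyap; lra.
Qed.

(** For a quadratic form q, (1 + t) q(a) + (1 + 1/t) q(b) - q(a + b) = q(t a - b) / t, which is
    nonnegative by [quad_lyap_ge]. *)
Lemma quad_lyapD_le t x z x' z' : L^T = L -> 0 < t -> 0 <= 1 + alpha / beta ->
  4 <= (1 + alpha / beta) * rho2 ->
  (forall w : 'M[R]_(n, d), w = t *: z - z' -> rho2 * ip w w <= ip w (L *m w)) ->
  quad_lyap (x + x') (z + z') <=
    (1 + t) * quad_lyap x z + (1 + t^-1) * quad_lyap x' z'.
Proof.
move=> Lsym t0 c0 c4 wU.
have := quad_lyap_ge (t *: x - x') c0 c4 (wU _ erefl).
have := ip_ge0 (t *: x - x').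
rewrite /quad_lyap !mulmxDr !mulmxN -!scalemxAr !ip_lin.
have sE a b : ip a (L *m b) = ip b (L *m a) :> R.
  by rewrite ipC ip_mulmx Lsym.
rewrite (sE d z' z) (ipC x' x).
set a := ip x x; set b := ip x x'; set c := ip x' x'.
set e := ip z _; set f := ip z _; set g := ip z' _.
set p1 := ip x z; set p2 := ip x z'; set p3 := ip x' z; set p4 := ip x' z'.
set k := 1 + alpha / beta => h1 h2.
rewrite -subr_ge0 -(pmulr_rge0 _ t0).
set s := t^-1.
have -> : t * ((1 + t) * (2^-1 * a + k / 2 * e + p1) +
  (1 + s) * (2^-1 * c + k / 2 * g + p4) -
  (2^-1 * (a + b + (b + c)) + k / 2 * (e + f + (f + g)) + (p1 + p2 + (p3 + p4)))) =
  t * t * (2^-1 * a + k / 2 * e + p1) + (t * s) * (2^-1 * c + k / 2 * g + p4)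
   - t * (b + k * f + p2 + p3) by field.
rewrite divff ?gt_eqF//.
lra.
Qed.

End Lyapunov.

(** * Decrease of the quadratic part along an error-free step *)

Section Descent.
Context {R : realType} {n d : nat}.
Implicit Types (x z y h : 'M[R]_(n, d)).

                                                                               
                                                                                
                        
(** Here [h] is the centred gradient disagreement, [y] the drift of the dual variable caused by the
    motion of the mean, and [G], [D] are n times the squared norms of the mean gradient and of its
    error. The terms in [D] and [G] on the left are the increments of the optimality gap. Expand the
    new value and bound each product by Young; the [eps] constants collect the coefficients, and the
    1/8 in [eps5] together with the final 3/8 balances the [eta / 2 * G] on the left. *)
Lemma quad_lyap_descent (L : 'M[R]_n) (alpha beta eta Lf rho rho2 D G : R) x z y h :
  let X := ip x x in let U := ip z (L *m z) in
  L^T = L -> (forall w : 'M[R]_(n, d), 0 <= ip w (L *m w)) ->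
  0 < beta -> beta <= alpha -> 0 < rho2 -> 0 < eta -> 0 <= D ->
  rho2 * X <= ip x (L *m x) ->
  ip (L *m x) (L *m x) <= rho ^+ 2 * X ->
  rho2 * ip z z <= U -> ip (L *m z) (L *m z) <= rho * U ->
  beta ^+ 2 * rho2 * ip y (L *m y) <= eta ^+ 2 * Lf ^+ 2 * G ->
  beta ^+ 2 * rho2 ^+ 2 * ip y y <= eta ^+ 2 * Lf ^+ 2 * G ->
  beta ^+ 2 * ip (L *m y) (L *m y) <= eta ^+ 2 * Lf ^+ 2 * G ->
  ip h h + D <= Lf ^+ 2 * X ->
  quad_lyap L alpha beta (x - eta *: (alpha *: (L *m x) + beta *: (L *m z) + h))
                         (z + (eta * beta) *: x + y)
    + eta / 2 * D + eta ^+ 2 * Lf / 2 * G - eta / 2 * G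
  <= quad_lyap L alpha beta x z
    - eta * (eps1 alpha beta Lf rho2 - eta * teps2 alpha beta Lf rho) * X
    - eta * (eps3 beta rho2 - eta * teps4 beta rho rho2) * U
    - eta * (eps5 alpha beta Lf rho2 - eta * eps6 alpha beta Lf rho2) * G
    - 3 / 8 * eta * G.
Proof.
move=> X U Lsym Lpos b0 ba r20 e0 D0 xLx LxLx zz LzLz yLy yy LyLy hD.
have sE a b : ip (L *m a) b = ip a (L *m b) :> R by rewrite ip_mulmx Lsym.
have bN0 : beta != 0 by rewrite gt_eqF.
have rN0 : rho2 != 0 by rewrite gt_eqF.
have eN0 : eta != 0 by rewrite gt_eqF.
have a0 : 0 < alpha by lra.
have X0 : 0 <= X := ip_ge0 x.
have U0 : 0 <= U := Lpos z.
have c0 : 0 < alpha + beta by lra.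
have e2 : 0 < eta ^+ 2 by rewrite exprn_gt0.
pose r := rho2^-1.
pose Kc := (alpha + beta) ^+ 2 * Lf ^+ 2 / (beta ^+ 5 * rho2).
pose Ky := Lf ^+ 2 / (2 * beta ^+ 2 * rho2 ^+ 2).
pose Kd := (alpha + beta) * Lf ^+ 2 / (2 * beta ^+ 3 * rho2).
(* [F1] is the dissipation in x. Each later [F] bounds a product of the expansion; the first-order
   <x, L z> terms cancel and need none. *)
have F1 := ler_wpM2l (ltW (mulr_gt0 e0 a0)) xLx.
have F2 : 0 <= eta / 2 * ip (x + h) (x + h).
  by rewrite mulr_ge0 ?ip_ge0// divr_ge0// ltW.
have F4 : 0 <= eta / 2 * ip (h + z) (h + z).
  by rewrite mulr_ge0 ?ip_ge0// divr_ge0// ltW.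
have F4' : eta / 2 * ip z z <= eta / 2 * (r * U).
  by rewrite ler_pM2l ?divr_gt0// /r -ler_pdivrMl ?invr_gt0// invrK.
have F5a : (1 + alpha / beta) * ip z (L *m y) <=
    eta * beta / 4 * U + eta * Kc * G.
  (* This parameter leaves exactly eta beta / 4 of <z, L z>, paid from the dissipation eta beta <z,
     L z>. *)
  have t0 : 0 < eta * beta ^+ 2 / (2 * (alpha + beta)).
    by rewrite divr_gt0// mulr_gt0// exprn_gt0.
  have := ip_young_psd z y Lsym Lpos t0; rewrite -/U => yg.
  have k0 : 0 < (alpha + beta) / (2 * beta).
    by rewrite divr_gt0// mulr_gt0.
  have := ler_wpM2l (ltW k0) yg.
  have -> : (alpha + beta) / (2 * beta) * (2 * ip z (L *m y)) =
     (1 + alpha / beta) * ip z (L *m y) by field.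
  move=> /le_trans; apply; rewrite mulrDr.
  have -> : (alpha + beta) / (2 * beta) * (eta * beta ^+ 2 / (2 * (alpha + beta)) * U) =
     eta * beta / 4 * U by field; rewrite bN0 gt_eqF.
  rewrite lerD2l.
  have := ler_wpM2l _ yLy => /(_ ((alpha + beta) ^+ 2 / (beta ^+ 5 * rho2 * eta))).
  have -> : (alpha + beta) ^+ 2 / (beta ^+ 5 * rho2 * eta) *
     (beta ^+ 2 * rho2 * ip y (L *m y)) = (alpha + beta) / (2 * beta) *
     ((eta * beta ^+ 2 / (2 * (alpha + beta)))^-1 * ip y (L *m y)).
    by field; rewrite bN0 rN0 eN0 gt_eqF.
  have -> : (alpha + beta) ^+ 2 / (beta ^+ 5 * rho2 * eta) *
     (eta ^+ 2 * Lf ^+ 2 * G) = eta * Kc * G.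
    by rewrite /Kc; field; rewrite bN0 rN0 eN0.
  by apply; rewrite divr_ge0 ?sqr_ge0// ltW// !mulr_gt0// exprn_gt0.
have yK : ip y y <= 2 * eta ^+ 2 * Ky * G.
  rewrite -(ler_pM2l (_ : 0 < beta ^+ 2 * rho2 ^+ 2)) ?mulr_gt0 ?exprn_gt0//.
  by apply: le_trans yy _; rewrite le_eqVlt /Ky; apply/orP; left; apply/eqP; field; rewrite bN0 rN0.
have F5b : ip x y <= eta / 2 * X + eta * Ky * G.
  have yg := ip_young x y e0; rewrite -/X in yg.
  have : eta^-1 * ip y y <= eta^-1 * (2 * eta ^+ 2 * Ky * G).
    by rewrite ler_pM2l ?invr_gt0.
  have -> : eta^-1 * (2 * eta ^+ 2 * Ky * G) = 2 * eta * Ky * G by field.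
  lra.
(* Three squares that yield |a + b + c|^2 <= 3 (|a|^2 + |b|^2 + |c|^2) for the second-order term. *)
have F61 : 0 <= eta ^+ 2 / 2 * ip (alpha *: (L *m x) - beta *: (L *m z)) (alpha *: (L *m x) - beta *: (L *m z)).
  by rewrite mulr_ge0 ?ip_ge0// divr_ge0// ltW.
have F62 : 0 <= eta ^+ 2 / 2 * ip (alpha *: (L *m x) - h) (alpha *: (L *m x) - h).
  by rewrite mulr_ge0 ?ip_ge0// divr_ge0// ltW.
have F63 : 0 <= eta ^+ 2 / 2 * ip (beta *: (L *m z) - h) (beta *: (L *m z) - h).
  by rewrite mulr_ge0 ?ip_ge0// divr_ge0// ltW.
have F64 : eta ^+ 2 * alpha ^+ 2 * ip (L *m x) (L *m x) <= eta ^+ 2 * alpha ^+ 2 * (rho ^+ 2 * X).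
  by rewrite ler_pM2l// mulr_gt0// exprn_gt0.
have F65 : eta ^+ 2 * beta ^+ 2 * ip (L *m z) (L *m z) <= eta ^+ 2 * beta ^+ 2 * (rho * U).
  by rewrite ler_pM2l// mulr_gt0// exprn_gt0.
have F7 : (1 + alpha / beta) / 2 * ip y (L *m y) <= eta ^+ 2 * Kd * G.
  have k0 : 0 <= (alpha + beta) / (2 * beta ^+ 3 * rho2).
    by rewrite divr_ge0 ?ltW// !mulr_gt0// exprn_gt0.
  have := ler_wpM2l k0 yLy.
  have -> : (alpha + beta) / (2 * beta ^+ 3 * rho2) * (beta ^+ 2 * rho2 * ip y (L *m y)) =
    (1 + alpha / beta) / 2 * ip y (L *m y) by field; rewrite bN0 rN0.
  by move=> /le_trans; apply; rewrite le_eqVlt /Kd; apply/orP; left; apply/eqP; field; rewrite bN0 rN0.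
(* Outside that square, the second-order terms in <x, L x> sum to -eta^2 beta (alpha - beta) / 2 <x,
   L x>, which has the right sign since beta <= alpha. *)
have F8 : 0 <= eta ^+ 2 * beta * (alpha - beta) / 2 * ip x (L *m x).
  by rewrite mulr_ge0// divr_ge0// !mulr_ge0 ?subr_ge0// ltW.
have F9 : 0 <= eta ^+ 2 * beta ^+ 2 / 2 * ip (x + L *m z) (x + L *m z).
  by rewrite mulr_ge0 ?ip_ge0// divr_ge0// mulr_ge0 ?sqr_ge0.
have F10 : 0 <= eta ^+ 2 / 2 * ip (beta *: x + h) (beta *: x + h).
  by rewrite mulr_ge0 ?ip_ge0// divr_ge0// ltW.
have F11 : 0 <= 2^-1 * ip (eta *: x - beta *: (L *m y)) (eta *: x - beta *: (L *m y)).
  by rewrite mulr_ge0 ?ip_ge0.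
have F12 : - (eta * beta) * ip z (L *m y) <= eta ^+ 2 * r * U + eta ^+ 2 * Lf ^+ 2 * G / 4.
  have t0 : 0 < 2 * eta * r / beta.
    by rewrite divr_gt0// !mulr_gt0// invr_gt0.
  have := ip_young_psd (- z) y Lsym Lpos t0.
  rewrite mulmxN !ip_lin opprK -/U => yg.
  have k0 : 0 < eta * beta / 2 by rewrite divr_gt0// mulr_gt0.
  have := ler_wpM2l (ltW k0) yg.
  have -> : eta * beta / 2 * (2 * - ip z (L *m y)) = - (eta * beta) * ip z (L *m y) by field.
  move=> /le_trans; apply; rewrite mulrDr.
  have -> : eta * beta / 2 * (2 * eta * r / beta * U) = eta ^+ 2 * r * U by field.
  have -> : eta * beta / 2 * ((2 * eta * r / beta)^-1 * ip y (L *m y)) =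
    beta ^+ 2 * rho2 * ip y (L *m y) / 4.
    by rewrite /r; field; rewrite bN0 rN0 eN0.
  lra.
have F13 : 0 <= 2^-1 * ip (eta *: h + y) (eta *: h + y).
  by rewrite mulr_ge0 ?ip_ge0.
have H1 : eta * (ip h h + D) <= eta * (Lf ^+ 2 * X) by rewrite ler_pM2l.
have H2 : eta ^+ 2 * (ip h h + D) <= eta ^+ 2 * (Lf ^+ 2 * X) by rewrite ler_pM2l.
(* Nonnegative slack terms: the [eps] constants exceed what the expansion costs. *)
have P1 : 0 <= eta * alpha * rho2 * X by rewrite !mulr_ge0// ltW.
have P2 : 0 <= eta * beta * X by rewrite !mulr_ge0// ltW.
have P3 : 0 <= eta * beta * U by rewrite !mulr_ge0// ltW.
have P4 : 0 <= eta * r * U by rewrite !mulr_ge0 ?invr_ge0// ltW.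
have P5 : 0 <= eta ^+ 2 * beta ^+ 2 * X by exact: mulr_ge0 (mulr_ge0 (sqr_ge0 _) (sqr_ge0 _)) X0.
have P6 : 0 <= eta ^+ 2 * Lf ^+ 2 * X by exact: mulr_ge0 (mulr_ge0 (sqr_ge0 _) (sqr_ge0 _)) X0.
have P7 : 0 <= eta ^+ 2 * alpha ^+ 2 * rho ^+ 2 * X.
  exact: mulr_ge0 (mulr_ge0 (mulr_ge0 (sqr_ge0 _) (sqr_ge0 _)) (sqr_ge0 _)) X0.
have P8 : 0 <= eta ^+ 2 * X by exact: mulr_ge0 (sqr_ge0 _) X0.
have P9 : 0 <= eta ^+ 2 * D by exact: mulr_ge0 (sqr_ge0 _) D0.
have P10 : 0 <= eta * Lf ^+ 2 * X by exact: mulr_ge0 (mulr_ge0 (ltW e0) (sqr_ge0 _)) X0.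
have P11 : 0 <= eta * X by exact: mulr_ge0 (ltW e0) X0.
have P12 : 0 <= eta * D by exact: mulr_ge0 (ltW e0) D0.
rewrite /eps1 /eps3 /eps5 /eps6 /teps2 /teps4 -/Kc -/Kd -/Ky -/r.
move: F5a F7; rewrite /quad_lyap.
(* Writing alpha as k beta turns the products with alpha / beta into polynomials; the inner products
   then become opaque variables and the claim is linear in monomials. *)
have aE : alpha = alpha / beta * beta by field.
move: aE; set k := alpha / beta => aE F5a F7.
rewrite !mulmxDr -!scalemxAr.
have E1 : ip (L *m x) x = ip x (L *m x) by rewrite ipC.
have E2 : ip (L *m z) x = ip x (L *m z) by rewrite ipC.
have E3 : ip z (L *m x) = ip x (L *m z) by rewrite -sE ipC.
have E4 : ip (L *m x) z = ip x (L *m z) by rewrite sE.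
have E5 : ip (L *m y) x = ip x (L *m y) by rewrite ipC.
have E6 : ip y (L *m x) = ip x (L *m y) by rewrite -sE ipC.
have E7 : ip (L *m x) y = ip x (L *m y) by rewrite sE.
have E8 : ip (L *m z) z = ip z (L *m z) by rewrite sE.
have E9 : ip (L *m y) z = ip z (L *m y) by rewrite ipC.
have E10 : ip y (L *m z) = ip z (L *m y) by rewrite -sE ipC.
have E11 : ip (L *m z) y = ip z (L *m y) by rewrite sE.
have E12 : ip (L *m y) y = ip y (L *m y) by rewrite sE.
have E := (E1, E2, E3, E4, E5, E6, E7, E8, E9, E10, E11, E12, ipC h x,
  ipC z x, ipC y x, ipC y h, ipC z h, ipC y z, ipC (L *m z) (L *m x),
  ipC (L *m x) h, ipC (L *m z) h).
move: F1 F2 F4 F4' F5a F5b F61 F62 F63 F64 F65 F7 F8 F9 F10 F11 F12 F13.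
move: LyLy yK H1 H2; rewrite !ip_lin !E -/X -/U.
clear E E1 E2 E3 E4 E5 E6 E7 E8 E9 E10 E11 E12.
move: P1 P2 P3 P4 P5 P6 P7 P8 P9 P10 P11 P12.
clearbody Kc Kd Ky r k X U.
move: (ip (L *m x) (L *m x)) (ip x (L *m x)) (ip x (L *m z)) (ip x (L *m y))
  (ip z (L *m y)) (ip y (L *m y)) (ip x h) (ip h z) (ip x z) (ip x y) (ip h y)
  (ip z y) (ip (L *m x) (L *m z)) (ip h (L *m x)) (ip h (L *m z)) (ip y y)
  (ip z z) (ip h h) (ip (L *m z) (L *m z)) (ip (L *m y) (L *m y)) (ip z h) (ip h x).
clear -aE.
rewrite {}aE.
intros.
lra.
Qed.
End Descent.

                                  

(** * Spectral calculus for symmetric matrices *)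

Section SymmetricMatrix.
Context {R : realType} {n : nat}.

Lemma iter_diag_mxE (C : pzRingType) m (D : 'rV[C]_n) (Z : 'M[C]_(n, m)) k i j :
  iter k (mulmx (diag_mx D)) Z i j = D 0 i ^+ k * Z i j.
Proof.
elim: k i j => [|k IH] i j; first by rewrite expr0 mul1r.
rewrite iterS mul_diag_mx mxE IH mulrA exprS//.
Qed.

                                                                                
                                                                        
(** The weights are the squared norms of the coordinates of [X] in an orthonormal eigenbasis,
    obtained by unitary diagonalisation of [M] as a complex Hermitian matrix. As they do not depend
    on k, inequalities between quadratic forms in powers of [M] reduce to scalar ones at the
    eigenvalues. *)
Lemma symmetric_spectral_weights (M : 'M[R]_n) : M^T = M ->
  exists lam : 'I_n -> R, (forall i, eigenvalue M (lam i)) /\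
    forall m (X : 'M[R]_(n, m)), exists w : 'I_n -> R,
      (forall i, 0 <= w i) /\
      forall k, ip (iter k (mulmx M) X) X = \sum_i lam i ^+ k * w i.
Proof.
move=> Msym; pose c : {rmorphism R -> R[i]} := real_complex R; pose Mc := map_mx c M.
have cconj x : (c x)^* = c x.
  by apply/CrealP; apply/complex_realP; exists x.
have Mherm : Mc \is hermsymmx.
  apply/is_hermitianmxP; rewrite expr0 scale1r.
  by apply/matrixP => i j; rewrite !mxE cconj -{1}Msym mxE.
have Dreal := hermitian_spectral_diag_real Mherm.
have /orthomx_spectralP := hermitian_normalmx Mherm.
have Pu := spectral_unitarymx Mc.
move: (spectralmx Mc) (spectral_diag Mc) Dreal Pu => P D Dreal Pu McE.
have Punit := unitarymx_unit Pu.
have DE i : D 0 i = c (complex.Re (D 0 i)) by exact: esym (RRe_real (mxOverP Dreal _ _)).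
have PM : P *m Mc = diag_mx D *m P by rewrite {1}McE !mulmxA mulmxV// mul1mx.
exists (fun i => complex.Re (D 0 i)); split=> [i|m X].
  suff : eigenvalue Mc (D 0 i) by rewrite DE eigenvalue_map.
  apply/eigenvalueP; exists (row i P).
    by rewrite -row_mul PM row_mul row_diag_mx -scalemxAl -rowE.
  apply/eqP => /(congr1 (mulmx^~ (invmx P))); rewrite -row_mul mulmxV// mul0mx.
  by move/rowP => /(_ i); rewrite !mxE eqxx => /eqP; rewrite oner_eq0.
pose Z := P *m map_mx c X.
pose w i := \sum_j Z i j * (Z i j)^*.
have w0 i : 0 <= w i by apply: sumr_ge0 => j _; exact: mul_conjC_ge0.
have wE i : c (complex.Re (w i)) = w i by exact: RRe_real (ger0_real (w0 i)).
exists (fun i => complex.Re (w i)); split=> [i|k].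
  by have := w0 i; rewrite -[X in 0 <= X -> _]RRe_real ?ger0_real// ler0c.
apply: (@complexI R); rewrite -[LHS]/(c _) -[RHS]/(c _) [RHS]rmorph_sum.
have iterE : P *m map_mx c (iter k (mulmx M) X) = iter k (mulmx (diag_mx D)) Z.
  elim: k => [//|k IH]; rewrite !iterS -IH map_mxM -/Mc !mulmxA PM//.
have trE : c (ip (iter k (mulmx M) X) X) =
    \tr (map_mx c (iter k (mulmx M) X) *m (map_mx c X)^T).
  by rewrite /ip -trace_map_mx map_mxM map_trmx.
(* Inserting P^* P = 1 inside the trace exposes the diagonal form. *)
apply: (etrans trE); rewrite -[map_mx c (iter _ _ _)]mul1mx.
have <- : map_mx Num.conj P^T *m P = 1%:M.
  by rewrite -invmx_unitary// mulVmx.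
rewrite -!mulmxA mxtrace_mulC -!mulmxA mulmxA iterE /mxtrace.
apply: eq_bigr => i _; rewrite mxE rmorphM rmorphXn wE -DE.
rewrite mulr_sumr; apply: eq_bigr => j _.
rewrite iter_diag_mxE -mulrA; congr (_ * (_ * _)).
rewrite mxE /Z mxE rmorph_sum; apply: eq_bigr => l _.
by rewrite rmorphM !mxE/= cconj mulrC.
Qed.

End SymmetricMatrix.

(** * The graph Laplacian: energy, kernel, pseudo-inverse, eigenvalue bounds *)

Section Laplacian.
Context {R : realType} {n : nat} (A : 'M[R]_n).
Local Notation L := (laplacian A).

Lemma laplacian_mulmxE m (x : 'M[R]_(n, m)) i k :
  (L *m x) i k = \sum_j A i j * (x i k - x j k).
Proof.
rewrite mulmxBl mul_diag_mx !mxE mulr_suml -sumrB.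
by apply: eq_bigr => j _; rewrite mulrBr.
Qed.

Lemma ones_mulmxE m (x : 'M[R]_(n, m)) k :
  ((const_mx 1 : 'rV[R]_n) *m x) 0 k = \sum_i x i k.
Proof. by rewrite mxE; apply: eq_bigr => i _; rewrite mxE mul1r. Qed.

Hypothesis Awt : weighted_adjacency A.

Lemma laplacian_sym : L^T = L.
Proof. by case: Awt => As _ _; rewrite /laplacian raddfB /= tr_diag_mx As. Qed.

Lemma ones_laplacian : (const_mx 1 : 'rV[R]_n) *m L = 0.
Proof.
rewrite -laplacian_sym -[const_mx 1]trmxK -trmx_mul.
apply/rowP => k; rewrite [LHS]mxE [RHS]mxE laplacian_mulmxE big1// => j _.
by rewrite !mxE subrr mulr0.
Qed.

(** Symmetry of [A] allows i and j to be exchanged in the double sum; adding both forms completes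
    the squares. *)
Lemma laplacian_energy m (x : 'M[R]_(n, m)) :
  2 * ip x (L *m x) = \sum_i \sum_j A i j * \sum_k (x i k - x j k) ^+ 2.
Proof.
case: Awt => As _ _.
have S1 : ip x (L *m x) = \sum_i \sum_j \sum_k A i j * (x i k * (x i k - x j k)).
  rewrite ipE; apply: eq_bigr => i _; rewrite exchange_big.
  apply: eq_bigr => k _; rewrite laplacian_mulmxE mulr_sumr.
  by apply: eq_bigr => j _; rewrite mulrCA.
have S2 : ip x (L *m x) = \sum_i \sum_j \sum_k A i j * (x j k * (x j k - x i k)).
  rewrite S1 exchange_big; apply: eq_bigr => i _; apply: eq_bigr => j _.
  by apply: eq_bigr => k _; rewrite -{1}As mxE.
rewrite mulr2n mulrDl mul1r {1}S1 S2 -big_split; apply: eq_bigr => i _ /=.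
rewrite -big_split; apply: eq_bigr => j _ /=; rewrite mulr_sumr -big_split.
by apply: eq_bigr => k _ /=; ring.
Qed.

Lemma laplacian_ge0 m (x : 'M[R]_(n, m)) : 0 <= ip x (L *m x).
Proof.
rewrite -(pmulr_rge0 _ (ltr0n R 2)) laplacian_energy; case: Awt => _ A0 _.
do 2!(apply: sumr_ge0 => ? _); rewrite mulr_ge0// sumr_ge0// => k _.
exact: sqr_ge0.
Qed.

Lemma laplacian_eigenvalue_ge0 (a : R) : eigenvalue L a -> 0 <= a.
Proof.
move=> /eigenvalueP[v vE v0].
have := laplacian_ge0 v^T.
rewrite -[L]laplacian_sym -trmx_mul vE linearZ/= ipZr.
have : 0 < ip v^T v^T.
  rewrite lt_neqAle ip_ge0 andbT eq_sym; apply: contra v0 => /eqP/ip_eq0/eqP.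
  by rewrite trmx_eq0.
by move=> vv; rewrite pmulr_lge0.
Qed.

Hypothesis Aconn : connected_graph A.

(** The energy vanishes, so rows agree across every edge, and a path carries the agreement between
    any two vertices. *)
Lemma laplacian_ker m (x : 'M[R]_(n, m)) i j : L *m x = 0 -> row i x = row j x.
Proof.
move=> Lx0; have := laplacian_energy x.
rewrite Lx0 ipC ip0l mulr0 => /esym; case: Awt => _ A0 _ /eqP.
have pos i' j' : 0 <= A i' j' * (\sum_k (x i' k - x j' k) ^+ 2).
  by rewrite mulr_ge0// sumr_ge0// => k _; exact: sqr_ge0.
rewrite psumr_eq0 => [/allP E|? _]; last exact: sumr_ge0.
have step i' j' : 0 < A i' j' -> row i' x = row j' x.
  move=> A'; have /= := E i' (mem_index_enum _).
  rewrite psumr_eq0 => [/allP/(_ j' (mem_index_enum _))/=|? _//].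
  rewrite mulf_eq0 gt_eqF//= psumr_eq0 => [/allP E'|k _]; last exact: sqr_ge0.
  apply/rowP => k; rewrite !mxE; apply/eqP; rewrite -subr_eq0.
  by have := E' k (mem_index_enum _); rewrite /= expf_eq0.
have /connectP[p] := Aconn i j.
elim: p i => [|y p IH] i /= => [_ ->//|/andP[/step -> pth] lastE].
exact: IH.
Qed.

                                                                        
                                                    
(** Adding u^T u, with u the all-ones row, makes the Laplacian invertible and changes nothing on
    columns of zero sum, so that inverse acts there as a pseudo-inverse. *)
Lemma laplacian_pinv : (0 < n)%N -> exists Q : 'M[R]_n, forall m (x : 'M[R]_(n, m)),
  (const_mx 1 : 'rV[R]_n) *m x = 0 ->
  L *m (Q *m x) = x /\ (const_mx 1 : 'rV[R]_n) *m (Q *m x) = 0.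
Proof.
move=> n0; pose u : 'rV[R]_n := const_mx 1.
have uu : u *m u^T = n%:R%:M.
  apply/rowP => i; rewrite !mxE (eq_bigr (fun=> 1)) => [|j _]; last first.
    by rewrite !mxE mulr1.
  by rewrite sumr_const card_ord ord1 eqxx mulr1n.
have nR : (n%:R : R) != 0 by rewrite pnatr_eq0 -lt0n.
have uJ : u *m (u^T *m u) = n%:R *: u.
  by rewrite mulmxA uu mul_scalar_mx.
pose J := L + u^T *m u.
(* A kernel vector has zero sum (multiply by u), hence is killed by L, hence is constant, hence is
   zero. *)
have Junit : J \in unitmx.
  rewrite -row_free_unit -kermx_eq0; apply/eqP.
  have : kermx J *m J = 0 by exact: mulmx_ker.
  move: (kermx J) => K KJ.
  have Jsym : J^T = J by rewrite /J raddfD/= [L^T]laplacian_sym trmx_mul trmxK.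
  have JK : J *m K^T = 0 by rewrite -Jsym -trmx_mul KJ trmx0.
  have uK : u *m K^T = 0.
    have := congr1 (mulmx u) JK.
    rewrite mulmxDl mulmxDr !mulmxA [u *m L]ones_laplacian mul0mx add0r mulmx0.
    rewrite -(mulmxA u) uJ -scalemxAl => /eqP; rewrite scaler_eq0 (negPf nR).
    by move=> /eqP.
  have LK : L *m K^T = 0.
    by have := JK; rewrite /J mulmxDl -mulmxA uK mulmx0 addr0.
  apply: trmx_inj; rewrite trmx0; apply/matrixP => i k; rewrite [RHS]mxE.
  have : \sum_j K^T j k = 0 by rewrite -ones_mulmxE -/u uK mxE.
  rewrite (eq_bigr (fun=> K^T i k)) => [|j _]; last first.
    by have /rowP/(_ k) := laplacian_ker j i LK; rewrite !mxE.
  by rewrite sumr_const card_ord -mulr_natl => /eqP; rewrite mulf_eq0 (negPf nR) => /eqP.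
exists (invmx J) => m x ux.
have : J *m (invmx J *m x) = x by rewrite mulKVmx.
move: (invmx J *m x) => y Jy.
have uy : u *m y = 0.
  have := congr1 (mulmx u) Jy; rewrite -/u in ux; rewrite ux.
  rewrite mulmxDl mulmxDr !mulmxA [u *m L]ones_laplacian !mul0mx add0r.
  rewrite -(mulmxA u) uJ -!scalemxAl => /eqP; rewrite scaler_eq0 (negPf nR).
  by move=> /eqP.
split=> //; move: Jy; rewrite /J mulmxDl -[in X in _ + X]mulmxA uy mulmx0 addr0.
exact.
Qed.

Local Notation rho := (spectral_radius L).
Local Notation rho2 := (smallest_pos_eigenvalue L).

(** Finiteness makes the supremum defining the spectral radius bounded and the infimum of positive
    eigenvalues positive. *)
Lemma eigenvalue_finite (M : 'M[R]_n) : exists rs : seq R[i],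
  forall z, eigenvalue (map_mx (real_complex R) M) z -> z \in rs.
Proof.
have [rs rsE] := closed_field_poly_normal (char_poly (map_mx (real_complex R) M)).
exists rs => z; rewrite eigenvalue_root_char rsE (monicP (char_poly_monic _)).
by rewrite scale1r root_prod_XsubC.
Qed.

Lemma eigenvalue_le_spectral_radius (M : 'M[R]_n) a :
  eigenvalue M a -> `|a| <= spectral_radius M.
Proof.
move=> Ma; apply: ub_le_sup; last first.
  exists (real_complex R a).
    by rewrite (eigenvalue_map (real_complex R)).
  by rewrite /= expr0n addr0 sqrtr_sqr.
have [rs rsP] := eigenvalue_finite M.
exists (\sum_(z <- rs) ComplexField.Normc.normc z) => _ [z /rsP zrs ->].
have normc0 (y : R[i]) : 0 <= ComplexField.Normc.normc y.
  by case: y => ? ?; rewrite sqrtr_ge0.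
by rewrite (big_rem z)//= lerDl sumr_ge0.
Qed.

Lemma smallest_pos_eigenvalue_le (M : 'M[R]_n) a :
  eigenvalue M a -> 0 < a -> smallest_pos_eigenvalue M <= a.
Proof.
by move=> Ma a0; apply: ge_inf => //; exists 0 => x [/ltW].
Qed.

Lemma smallest_pos_eigenvalue_gt0 (M : 'M[R]_n) a :
  eigenvalue M a -> 0 < a -> 0 < smallest_pos_eigenvalue M.
Proof.
move=> Ma a0.
have [rs rsP] := eigenvalue_finite M.
(* The minimum of 1 and the positive real parts in the list; only its positivity matters. *)
have [m m0 mle] : exists2 m, 0 < m &
    forall z, z \in rs -> 0 < complex.Re z -> m <= complex.Re z.
  elim: (rs) => [|z s [m m0 mle]]; first by exists 1.
  exists (if 0 < complex.Re z then Order.min m (complex.Re z) else m).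
    by case: ifP => // z0; rewrite lt_min m0.
  move=> y; rewrite inE => /predU1P[->|ys] y0; first by rewrite y0 ge_min lexx orbT.
  by case: ifP => _; rewrite ?ge_min mle.
apply: (lt_le_trans m0); apply: lb_le_inf; first by exists a.
move=> b /= [b0 Mb]; apply: (mle (real_complex R b)) => //.
by apply: rsP; rewrite (eigenvalue_map (real_complex R)).
Qed.

Hypothesis n2 : (2 <= n)%N.

(** Otherwise every eigenvalue is zero, so |L|^2 = <L^2 I, I> = 0, and [laplacian_ker] applied to
    the identity matrix equates two distinct rows of it. *)
Lemma laplacian_pos_eigenvalue : exists2 a, eigenvalue L a & 0 < a.
Proof.
have [lam [lamE lamw]] := symmetric_spectral_weights laplacian_sym.
case: (pselect (exists i, 0 < lam i)) => [[i li]|np]; first by exists (lam i).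
have lam0 i : lam i = 0.
  apply/eqP; rewrite eq_le laplacian_eigenvalue_ge0// andbT leNgt.
  by apply/negP => li; apply: np; exists i.
have L0 : L = 0.
  have [w [_ wE]] := lamw _ (1%:M : 'M[R]_n).
  have := wE 2%N.
  rewrite big1 => [|i _]; last by rewrite lam0 expr0n mul0r.
  rewrite /= mulmx1 ip_mulmx laplacian_sym mulmx1.
  exact: ip_eq0.
exfalso.
pose i0 : 'I_n := Ordinal (ltnW n2); pose i1 : 'I_n := Ordinal n2.
have := laplacian_ker (x := 1%:M) i0 i1.
rewrite L0 mul0mx => /(_ erefl)/rowP/(_ i0).
by rewrite !mxE eqxx /= => /eqP; rewrite oner_eq0.
Qed.

Lemma laplacian_rho2_gt0 : 0 < rho2.
Proof.
by have [a La a0] := laplacian_pos_eigenvalue; exact: smallest_pos_eigenvalue_gt0 La a0.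
Qed.

Lemma laplacian_rho2_le a : eigenvalue L a -> a = 0 \/ rho2 <= a.
Proof.
move=> La; have := laplacian_eigenvalue_ge0 La; rewrite le_eqVlt.
by move=> /predU1P[<-|a0]; [left|right; exact: smallest_pos_eigenvalue_le].
Qed.

Lemma laplacian_le_rho a : eigenvalue L a -> 0 <= a <= rho.
Proof.
move=> La; rewrite laplacian_eigenvalue_ge0//=.
exact: le_trans (ler_norm _) (eigenvalue_le_spectral_radius La).
Qed.

Lemma laplacian_rho_ge0 : 0 <= rho.
Proof.
have [a La a0] := laplacian_pos_eigenvalue.
by have /andP[] := laplacian_le_rho La; exact: le_trans.
Qed.

(** Compare the spectral sums term by term: each eigenvalue is at most rho, and is either 0 or at
    least rho2. The last inequality is coercivity on the range of L. *)
Lemma laplacian_spectral m (x : 'M[R]_(n, m)) :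
  [/\ ip x (L *m x) <= rho * ip x x,
      rho2 * ip x (L *m x) <= ip (L *m x) (L *m x),
      ip (L *m x) (L *m x) <= rho * ip x (L *m x),
      ip (L *m x) (L *m x) <= rho ^+ 2 * ip x x &
      rho2 * ip (L *m x) (L *m x) <= ip (L *m x) (L *m (L *m x))].
Proof.
have [lam [lamE lamw]] := symmetric_spectral_weights laplacian_sym.
have [w [w0 wE]] := lamw _ x.
have E0 : ip x x = \sum_i lam i ^+ 0 * w i by exact: (wE 0%N).
have E1 : ip x (L *m x) = \sum_i lam i ^+ 1 * w i by rewrite ipC; exact: (wE 1%N).
have E2 : ip (L *m x) (L *m x) = \sum_i lam i ^+ 2 * w i.
  by rewrite -wE /= [RHS]ip_mulmx laplacian_sym.
have E3 : ip (L *m x) (L *m (L *m x)) = \sum_i lam i ^+ 3 * w i.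
  by rewrite -wE /= [RHS]ip_mulmx laplacian_sym ipC.
rewrite E0 E1 E2 E3 !mulr_sumr; split; apply: ler_sum => i _.
- rewrite expr1 expr0 mul1r ler_wpM2r//.
  by have /andP[] := laplacian_le_rho (lamE i).
- rewrite mulrA ler_wpM2r// expr1 expr2.
  have [->|lr] := laplacian_rho2_le (lamE i); first by rewrite !mulr0.
  by rewrite ler_wpM2r// (le_trans _ lr)// ltW// laplacian_rho2_gt0.
- rewrite mulrA ler_wpM2r// expr1 expr2.
  by have /andP[l0 lr] := laplacian_le_rho (lamE i); rewrite ler_wpM2r.
- rewrite expr0 mul1r ler_wpM2r//.
  by have /andP[l0 lr] := laplacian_le_rho (lamE i); rewrite lerXn2r// nnegrE// (le_trans l0).
- rewrite mulrA ler_wpM2r//.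
  have [->|lr] := laplacian_rho2_le (lamE i); first by rewrite !expr0n/= mulr0.
  by rewrite (exprS _ 2) ler_wpM2r// sqr_ge0.
Qed.

End Laplacian.

                                       

(** * Borel structure of R^d *)

Section BorelVectors.
Context {R : realType} {d : nat}.
Local Notation rV := (borel_rV R d).

Lemma continuous_measurable_rV (f : 'rV[R]_d -> R) :
  continuous f -> measurable_fun [set: rV] (f : rV -> R).
Proof.
move=> /continuousP cf; apply: (measurability _ (RGenOpens.measurableE R)).
move=> _ [_ [a [b ->] <-]]; rewrite setTI; apply: sub_sigma_algebra.
exact/cf/interval_open.
Qed.

Lemma measurable_coord_rV j : measurable_fun [set: rV] (fun z : rV => z 0 j : R).
Proof.
by apply: (@continuous_measurable_rV (fun z => z 0 j)); exact: coord_continuous.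
Qed.

Lemma open_rV_rational_balls (U : set 'rV[R]_d) : open U ->
  exists S : set ('rV[rat]_d * rat),
    U = \bigcup_(c in S) ball (map_mx ratr c.1 : 'rV[R]_d) (ratr c.2 : R).
Proof.
move=> oU; exists [set c | ball (map_mx ratr c.1 : 'rV[R]_d) (ratr c.2 : R) `<=` U].
apply/seteqP; split=> [x Ux|x [c] cU]; last exact: cU.
have /nbhs_ballP[e /= e0 eU] : nbhs x U by exact: open_nbhs_nbhs.
have [r] := rat_in_itvoo (divr_gt0 e0 (ltr0n R 2)).
rewrite in_itv/= => /andP[r0 re].
have near_rat j : exists q : rat, `|(ratr q : R) - x 0 j| < ratr r.
  have /rat_in_itvoo[q] : x 0 j - ratr r < x 0 j + ratr r.
    by rewrite ltrBlDr -addrA ltrDl addr_gt0.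
  by rewrite in_itv/= -ltr_distlC => ?; exists q; rewrite distrC.
have [g gP] := choice near_rat; pose q := \row_j g j.
have qx i j : `|map_mx ratr q i j - x i j| < ratr r.
  by rewrite ord1 !mxE; exact: gP.
exists (q, r); last by split=> // i j; exact: qx.
move=> y [_ qy]; apply: eU; split=> // i j; rewrite /ball/=.
rewrite (splitr e) -(subrK (map_mx ratr q i j) (x i j)) -addrA.
apply: le_lt_trans (ler_normD _ _) _; rewrite ltrD//.
  by rewrite distrC; exact: lt_trans (qx _ _) re.
exact: lt_trans (qy _ _) re.
Qed.

(** An open set is a countable union of rational max-norm balls, and such a ball is a finite
    intersection of conditions on single coordinates. *)
Lemma measurable_rV_coord dS (S : measurableType dS) (h : S -> 'rV[R]_d) :
  (forall j, measurable_fun [set: S] (fun s => h s 0 j)) ->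
  measurable_fun [set: S] (h : S -> rV).
Proof.
move=> mh; apply: (@measurability _ _ S rV _ h (@open _)) => // _ [U oU <-]; rewrite setTI.
have [Q ->] := open_rV_rational_balls oU.
rewrite preimage_bigcup bigcup_mkcond; apply: countable_bigcupT_measurable => //.
move=> c; case: ifP => // _.
(* A ball of nonpositive radius is empty. *)
have [r0|r0] := leP (ratr c.2 : R) 0.
  rewrite (_ : _ @^-1` _ = set0)//; apply/seteqP; split=> // s [] /=.
  by rewrite ltNge r0.
rewrite (_ : _ @^-1` _ = ~` \bigcup_(j : 'I_d)
  ~` ((fun s => h s 0 j) @^-1` ball ((map_mx ratr c.1 : 'rV[R]_d) 0 j) (ratr c.2 : R))).
  apply/measurableC/countable_bigcupT_measurable => // j.
  apply: measurableC; rewrite -[X in measurable X]setTI.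
  by apply: mh => //; apply: open_measurable; apply: ball_open; exact: r0.
rewrite setC_bigcup; apply/seteqP; split=> s /=.
  by move=> [_ sb] j _; rewrite setCK; exact: sb.
move=> sb; split=> // i j; rewrite ord1.
by have := sb j Logic.I; rewrite setCK.
Qed.

End BorelVectors.

(** * Independence of one seed from the others *)

Section Independence.
Context {R : realType} {dO dT : measure_display} {Omega : measurableType dO}
  {T : measurableType dT} (P : probability Omega R) {I : choiceType}
  (X : I -> Omega -> T).

                                                                           
(** A family stable under intersection that generates the sigma-algebra of the [X j] with [j] in
    [J]; it will model the past. *)
Definition cylinders (J : seq I) : set (set Omega) :=
  [set E | exists B : I -> set T, (forall j, measurable (B j)) /\
    E = \bigcap_(j in [set` J]) (X j @^-1` B j)].

Lemma cylinders_coord (J : seq I) j : j \in J ->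
  measurable_fun [set: g_sigma_algebraType (cylinders J)] (X j).
Proof.
move=> jJ _ B mB; rewrite setTI; apply: sub_sigma_algebra.
exists (fun i => if i == j then B else setT); split=> [i|].
  by case: ifP.
apply/seteqP; split=> w /=.
  by move=> Bw i _ /=; case: eqP => [->|].
by move=> /(_ j jJ); rewrite /= eqxx.
Qed.

Hypothesis mX : forall j, measurable_fun [set: Omega] (X j).

Lemma sub_cylinders_measurable (J : seq I) :
  <<s cylinders J >> `<=` @measurable _ Omega.
Proof.
apply: smallest_sub; first exact: sigma_algebra_measurable.
move=> _ [B [mB ->]].
rewrite -[X in measurable X]setCK setC_bigcap; apply: measurableC.
have -> : \bigcup_(i in [set` J]) ~` (X i @^-1` B i) =
    \big[setU/set0]_(i <- J) ~` (X i @^-1` B i).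
  by rewrite bigcup_seq.
apply: bigsetU_measurable => i _; apply: measurableC.
by rewrite -[X in measurable X]setTI; exact: mX.
Qed.

Lemma measurable_fun_cylinders dS (S : measurableType dS) (Z : Omega -> S) J :
  measurable_fun [set: g_sigma_algebraType (cylinders J)] Z ->
  measurable_fun [set: Omega] Z.
Proof.
move=> mZ _ B mB; rewrite setTI; apply: (@sub_cylinders_measurable J).
by have := mZ measurableT B mB; rewrite setTI.
Qed.

Hypothesis indX : mutually_independent P X.

(** Both sides are finite measures in [E] that agree on cylinders by mutual independence, hence on
    the generated sigma-algebra. *)
Lemma independent_cylinders (J : seq I) a (B : set T) E :
  uniq J -> a \notin J -> measurable B -> <<s cylinders J >> E ->
  P (X a @^-1` B `&` E) = (P (X a @^-1` B) * P E)%E.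
Proof.
move=> uJ aJ mB sE.
have mXB : measurable (X a @^-1` B) by rewrite -[X in measurable X]setTI; exact: mX.
have PB0 : (0 <= fine (P (X a @^-1` B)))%R by rewrite fine_ge0.
pose m1 : {measure set Omega -> \bar R} := mrestr P mXB.
pose m2 : {measure set Omega -> \bar R} := mscale (NngNum PB0) P.
have m1E A : m1 A = P (A `&` X a @^-1` B) by [].
have m2E A : m2 A = (P (X a @^-1` B) * P A)%E.
  transitivity ((fine (P (X a @^-1` B)))%:E * P A)%E; first by [].
  by rewrite fineK// fin_num_measure.
have m12 A : cylinders J A -> m1 A = m2 A.
  move=> [C [mC ->]]; rewrite m1E m2E indX// setIC.
  pose C' i := if i == a then B else C i.
  have C'E i : i \in J -> C' i = C i.
    by rewrite /C'; case: eqP => // -> aJ'; rewrite aJ' in aJ.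
  have mC' i : measurable (C' i) by rewrite /C'; case: ifP.
  have -> : X a @^-1` B `&` \bigcap_(j in [set` J]) (X j @^-1` C j) =
      \bigcap_(j in [set` a :: J]) (X j @^-1` C' j).
    apply/seteqP; split=> w /=.
      move=> [Bw Cw] i /=; rewrite inE => /predU1P[->|iJ]; first by rewrite /C' eqxx.
      by rewrite C'E//; exact: Cw.
    move=> C'w; split; first by have := C'w a (mem_head _ _); rewrite /C' eqxx.
    move=> i iJ; rewrite -C'E//; apply: C'w; rewrite /= inE.
    by apply/orP; right.
  rewrite indX//= ?aJ// big_cons /C' eqxx; congr (_ * _)%E.
  rewrite big_seq [RHS]big_seq; apply: eq_bigr => i iJ.
  by rewrite -/(C' i) C'E.
have sub A : [set A | cylinders J A /\ A `<=` setT] A = cylinders J A.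
  by apply/propext; split=> [[]|].
have subE : [set A | cylinders J A /\ A `<=` setT] = cylinders J.
  by apply/funext => A; rewrite sub.
have : m1 E = m2 E.
  apply: (g_sigma_algebra_measure_unique_trace (cylinders J) setT) => //; rewrite ?subE//.
  - by move=> A cA; apply: (@sub_cylinders_measurable J); exact: sub_sigma_algebra.
  - move=> _ _ [C [mC ->]] [D [mD ->]].
    exists (fun i => C i `&` D i); split=> [i|]; first exact: measurableI.
    apply/seteqP; split=> w /=.
      by move=> [Cw Dw] i iJ; split; [exact: Cw|exact: Dw].
    by move=> CDw; split=> i iJ; have [] := CDw i iJ.
  - by rewrite m1E m2E setTI probability_setT mule1.
  - rewrite m1E setTI; apply: le_lt_trans (probability_le1 _ _) _ => //.
    exact: ltry.
by rewrite m1E m2E setIC.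
Qed.

(** [Z] is a function of the seeds in [J], so the law of (X a, Z) is a product and Tonelli
    integrates over the seed first, with [Z] frozen. In this form the compressor bound holds
    conditionally on the past. *)
Lemma integral_independent_le dS (S : measurableType dS) (Z : Omega -> S)
    (PT : probability T R) (J : seq I) a (phi : T * S -> \bar R) (C : \bar R) :
  uniq J -> a \notin J ->
  (forall B, measurable B -> P (X a @^-1` B) = PT B) ->
  measurable_fun [set: g_sigma_algebraType (cylinders J)] Z ->
  measurable_fun setT phi -> (forall z, 0 <= phi z)%E ->
  (forall s, \int[PT]_t phi (t, s) <= C)%E ->
  (\int[P]_w phi (X a w, Z w) <= C)%E.
Proof.
move=> uJ aJ XaE mZ mphi phi0 phiC.
have mZ' := measurable_fun_cylinders mZ.
have mXZ : measurable_fun setT (fun w => (X a w, Z w)).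
  exact: measurable_fun_pair.
pose Zm : {mfun Omega >-> S} := HB.pack Z (isMeasurableFun.Build _ _ _ _ Z mZ').
pose XZ w := (X a w, Z w).
pose XZm : {mfun Omega >-> (T * S)%type} :=
  HB.pack XZ (isMeasurableFun.Build _ _ _ _ XZ mXZ).
have prodE E : measurable E -> (PT \x distribution P Zm)%E E = distribution P XZm E.
  apply: product_measure_unique => A B mA mB.
  rewrite /= /distribution /pushforward /= -XaE// -(independent_cylinders uJ aJ)//.
  by rewrite -[X in <<s _ >> X]setTI; exact: mZ.
rewrite -[leLHS](@ge0_integral_distribution _ _ _ _ _ P XZm phi)//.
rewrite (@eq_measure_integral _ _ _ _ (PT \x distribution P Zm)%E); last first.
  by move=> A mA _; exact: esym (prodE _ _).
rewrite fubini_tonelli1// fubini_tonelli//.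
apply: (@le_trans _ _ (\int[distribution P Zm]_s C)%E).
  apply: ge0_le_integral => //.
  - by move=> s _; exact: integral_ge0.
  - exact: measurable_fun_fubini_tonelli_G.
rewrite integral_cst// [X in (_ * X)%E](_ : _ = 1%E) ?mule1//.
exact: (probability_setT (distribution P Zm)).
Qed.

End Independence.

                         

(** * Norm comparison and smooth functions *)

Section Norms.
Context {R : realType} {d : nat}.
Implicit Types (x y : 'rV[R]_d).

Lemma norm2_sqr x : norm2 x ^+ 2 = ip x x.
Proof.
rewrite /norm2 /pnorm powR12_sqrt; last by apply: sumr_ge0 => j _; exact: powR_ge0.
rewrite sqr_sqrtr; last by apply: sumr_ge0 => j _; exact: powR_ge0.
rewrite ipE big_ord1; apply: eq_bigr => j _.
by rewrite powR_mulrn// real_normK ?num_real// expr2.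
Qed.

Lemma norm2_ge0 x : 0 <= norm2 x.
Proof. exact: powR_ge0. Qed.

(** Each coordinate is at most the p-norm in modulus; sum the d squares. *)
Lemma ip_le_pnorm (p : R) x : 1 <= p -> ip x x <= d%:R * pnorm p x ^+ 2.
Proof.
move=> p1; have p0 : p != 0 by rewrite gt_eqF// (lt_le_trans ltr01).
rewrite ipE big_ord1 mulr_natl -[X in _ *+ X](card_ord d) -sumr_const.
apply: ler_sum => j _; rewrite -expr2 -real_normK ?num_real//.
rewrite lerXn2r ?nnegrE ?powR_ge0//.
rewrite -[leLHS]powRr1// -(divff p0) powRrM.
rewrite ge0_ler_powR ?nnegrE ?powR_ge0//.
- by rewrite invr_ge0 (le_trans ler01).
- by apply: sumr_ge0 => i _; exact: powR_ge0.
- by rewrite (bigD1 j)//= lerDl; apply: sumr_ge0 => i _; exact: powR_ge0.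
Qed.

End Norms.

Section Smooth.
Context {R : realType} {d : nat} (f : 'rV[R]_d -> R).
Hypothesis df : forall z, differentiable f z.

Lemma derive_gradient x v : 'D_v f x = ip (gradient f x) v.
Proof.
rewrite deriveE// {1}(row_sum_delta v) linear_sum ipE big_ord1.
apply: eq_bigr => j _; rewrite linearZ mxE deriveE//.
exact: mulrC.
Qed.

Lemma is_derive_line x v (t : R) :
  is_derive t 1 (fun s : R => f (x + s *: v)) (ip (gradient f (x + t *: v)) v).
Proof.
have E : (fun h : R => h^-1 *: (f (x + (h *: 1 + t) *: v) - f (x + t *: v))) =
         (fun h : R => h^-1 *: (f (h *: v + (x + t *: v)) - f (x + t *: v))).
  apply/funext => h; congr (_ *: (f _ - _)).
  by rewrite -[h *: 1]/(h * 1) mulr1 scalerDl addrCA.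
apply: DeriveDef.
  rewrite /derivable /= E; exact: (diff_derivable (df _)).
rewrite -derive_gradient /derive /= E //.
Qed.

Variable (Lf : R).
Hypothesis Lf0 : 0 < Lf.
Hypothesis Lip : forall z z', norm2 (gradient f z - gradient f z') <= Lf * norm2 (z - z').

Lemma lip_gradient_sqr z z' :
  ip (gradient f z - gradient f z') (gradient f z - gradient f z') <=
  Lf ^+ 2 * ip (z - z') (z - z').
Proof.
rewrite -!norm2_sqr -exprMn lerXn2r ?nnegrE ?norm2_ge0//.
by rewrite mulr_ge0 ?norm2_ge0// ltW.
Qed.

(** The mean value theorem on [0, 1], applied to f along the segment minus the quadratic upper
    model, whose derivative is nonpositive. *)
Lemma smooth_upper_bound x v :
  f (x + v) <= f x + ip (gradient f x) v + Lf / 2 * ip v v.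
Proof.
pose g := fun t : R => f (x + t *: v) - (t * ip (gradient f x) v + t ^+ 2 * (Lf / 2 * ip v v)).
pose dg := fun t : R => ip (gradient f (x + t *: v)) v -
  (ip (gradient f x) v + 2 * t * (Lf / 2 * ip v v)).
have gd (t : R) : is_derive t 1 g (dg t).
  have := is_derive_line x v t => ?.
  apply: is_deriveB; apply: is_derive_eq.
  by rewrite /GRing.scale /=; ring.
have [|c c01] := @MVT R g dg 0 1 ltr01 (fun t _ => gd t).
  apply: continuous_subspaceT => t.
  by apply: differentiable_continuous; apply/derivable1_diffP; have [] := gd t.
rewrite subr0 mulr1 /g scale1r scale0r addr0 mul0r expr0n mul0r addr0 subr0 mul1r expr1n mul1r.
move: c01; rewrite in_itv /= => /andP[c0 c1].
suff : dg c <= 0 by move=> ? ?; lra.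
(* With Young parameter 1 / (Lf c), both halves are at most Lf c |v|^2, because the gradients differ
   by at most Lf c |v|. *)
have Lc : 0 < (Lf * c)^-1 by rewrite invr_gt0 mulr_gt0.
have := ip_young (gradient f (x + c *: v) - gradient f x) v Lc.
have := lip_gradient_sqr (x + c *: v) x.
rewrite [x + _]addrC addrK [_ + x]addrC ipZl ipZr.
set a := ip (_ - _) (_ - _) => aL; rewrite invrK ipDl ipNl /dg.
have : (Lf * c)^-1 * a <= Lf * c * ip v v.
  rewrite -ler_pdivlMl ?invr_gt0 ?mulr_gt0// invrK.
  by apply: le_trans aL _; rewrite le_eqVlt; apply/orP; left; apply/eqP; ring.
lra.
Qed.

Lemma continuous_gradient_coord j : continuous (fun z => gradient f z 0 j).
Proof.
move=> z; apply/(cvgrPdist_le (F := nbhs z) (FF := nbhs_filter z)) => e e0.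
(* Using d + 1 instead of d keeps the radius meaningful in dimension 0. *)
pose r := e / (Lf * d.+1%:R).
have r0 : 0 < r by rewrite divr_gt0// mulr_gt0.
near=> y.
have [_ zy] : ball z r y by near: y; exact: nbhsx_ballx.
rewrite -[leRHS]gtr0_norm// -ler_sqr ?nnegrE// -!normrX !ger0_norm ?sqr_ge0//.
have coord_le (u : 'rV[R]_d) : u 0 j ^+ 2 <= ip u u.
  rewrite ipE big_ord1 (bigD1 j)//= -expr2 lerDl.
  by apply: sumr_ge0 => i _; rewrite -expr2 sqr_ge0.
have := coord_le (gradient f z - gradient f y); rewrite [X in X ^+ 2]mxE [X in _ + X]mxE.
move=> /le_trans; apply; apply: le_trans (lip_gradient_sqr _ _) _.
have zyd : ip (z - y) (z - y) <= d.+1%:R ^+ 2 * r ^+ 2.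
  apply: (@le_trans _ _ (d%:R * r ^+ 2)); last first.
    rewrite ler_wpM2r ?sqr_ge0// -natrX ler_nat.
    by rewrite (leq_trans (leqnSn d))// -mulnn leq_pmulr.
  rewrite ipE big_ord1 mulr_natl -[X in _ *+ X](card_ord d) -sumr_const.
  apply: ler_sum => k _; rewrite -expr2 !mxE -real_normK ?num_real//.
  by rewrite lerXn2r ?nnegrE ?normr_ge0 ?(ltW r0)//; apply/ltW; exact: zy.
have -> : e ^+ 2 = Lf ^+ 2 * (d.+1%:R ^+ 2 * r ^+ 2).
  rewrite -!exprMn; congr (_ ^+ 2).
  by rewrite /r mulrA mulrC divfK// gt_eqF// mulr_gt0.
by rewrite ler_wpM2l ?sqr_ge0.
Unshelve. all: by end_near. Qed.

End Smooth.

                                  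

(** * Splitting a stack into its mean and its centred part *)

Section Centering.
Context {R : realType} {n : nat}.
Local Notation u := (const_mx 1 : 'rV[R]_n).

Definition centering : 'M[R]_n := 1%:M - n%:R^-1 *: (u^T *m u).

Definition mx_mean d (X : 'M[R]_(n, d)) : 'rV[R]_d := n%:R^-1 *: (u *m X).

Lemma centeringE d (X : 'M[R]_(n, d)) : centering *m X = X - u^T *m mx_mean X.
Proof. by rewrite mulmxBl mul1mx -scalemxAl -mulmxA -scalemxAr. Qed.

Lemma row_ones_mulmx d (z : 'rV[R]_d) i : row i (u^T *m z) = z.
Proof.
by apply/rowP => j; rewrite !mxE big_ord1 !mxE mul1r.
Qed.

Lemma mx_meanD d (X Y : 'M[R]_(n, d)) : mx_mean (X + Y) = mx_mean X + mx_mean Y.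
Proof. by rewrite /mx_mean mulmxDr scalerDr. Qed.

Lemma mx_meanZ d a (X : 'M[R]_(n, d)) : mx_mean (a *: X) = a *: mx_mean X.
Proof. by rewrite /mx_mean -scalemxAr !scalerA mulrC. Qed.

Lemma ip_rows d (X Y : 'M[R]_(n, d)) : ip X Y = \sum_i ip (row i X) (row i Y).
Proof.
rewrite ipE; apply: eq_bigr => i _; rewrite ipE big_ord1.
by apply: eq_bigr => j _; rewrite !mxE.
Qed.

Lemma ip_ones d (y z : 'rV[R]_d) : ip (u^T *m y) (u^T *m z) = n%:R * ip y z.
Proof.
rewrite ip_rows (eq_bigr (fun=> ip y z)) => [|i _]; last by rewrite !row_ones_mulmx.
by rewrite sumr_const card_ord mulr_natl.
Qed.

Hypothesis n0 : (0 < n)%N.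

Lemma mul_ones_ones : u *m u^T = n%:R%:M.
Proof.
apply/rowP => i; rewrite !mxE (eq_bigr (fun=> 1)) => [|j _]; last first.
  by rewrite !mxE mulr1.
by rewrite sumr_const card_ord ord1 eqxx mulr1n.
Qed.

Lemma ones_centering : u *m centering = 0.
Proof.
rewrite mulmxBr mulmx1 -scalemxAr mulmxA mul_ones_ones mul_scalar_mx scalerA.
by rewrite mulVf ?scale1r ?subrr// pnatr_eq0 -lt0n.
Qed.

Lemma centering_id d (X : 'M[R]_(n, d)) : u *m X = 0 -> centering *m X = X.
Proof. by move=> uX; rewrite centeringE /mx_mean uX scaler0 mulmx0 subr0. Qed.

(** Pythagoras: the constant part is orthogonal to the centred part because [u *m centering]
    vanishes. *)
Lemma ip_centering d (X : 'M[R]_(n, d)) :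
  ip X X = ip (centering *m X) (centering *m X) + n%:R * ip (mx_mean X) (mx_mean X).
Proof.
have cross : ip (centering *m X) (u^T *m mx_mean X) = 0.
  rewrite ipC ip_mulmx trmxK mulmxA ones_centering mul0mx.
  by rewrite ipC ip0l.
have E : X = centering *m X + u^T *m mx_mean X by rewrite centeringE subrK.
by rewrite [in LHS]E ipDl !ipDr (ipC (u^T *m mx_mean X) (centering *m X)) cross addr0 add0r ip_ones.
Qed.

Lemma ip_centering_le d (X : 'M[R]_(n, d)) :
  ip (centering *m X) (centering *m X) <= ip X X.
Proof. by rewrite [leRHS]ip_centering lerDl mulr_ge0 ?ler0n ?ip_ge0. Qed.

End Centering.

Lemma descent_arith (R : realFieldType) (q1 q0 X U F1 F0 D G G0 eta c k1 k3 k5 Lf t : R) :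
  q1 + eta / 2 * D + eta ^+ 2 * Lf / 2 * G - eta / 2 * G
    <= q0 - eta * k1 * X - eta * k3 * U - eta * k5 * G - 3 / 8 * eta * G ->
  F1 <= F0 + eta / 2 * D + eta ^+ 2 * Lf / 2 * G - eta / 2 * G - eta / 2 * G0 ->
  0 <= eta * k5 * G -> 0 <= eta * G ->
  eta * c * X <= eta * k1 * X -> eta * c * U <= eta * k3 * U ->
  eta * c * F0 <= eta / 2 * G0 ->
  t <= eta * c * (X + U + F0) -> q1 + F1 <= q0 + F0 - t.
Proof. lra. Qed.

(** Rests on (1 + (s - s')) (1 - s) = 1 - s' - s (s - s') <= 1 - s': lowering the rate from s to s'
    pays for the Young inflation. *)
Lemma lyap_step_arith (R : realFieldType) (q q1 qe F V s s' T c E : R) :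
  q <= (1 + (s - s')) * q1 + T * qe -> q1 + F <= (1 - s) * V -> qe <= c * E ->
  0 <= T -> 0 <= s - s' -> 0 <= s -> 0 <= V -> 0 <= F ->
  q + F <= (1 - s') * V + T * c * E.
Proof.
move=> qle qF qeE T0 t0 s0 V0 F0.
have h1 : (1 + (s - s')) * (q1 + F) <= (1 + (s - s')) * ((1 - s) * V).
  by rewrite ler_wpM2l// addr_ge0.
have h2 : T * qe <= T * (c * E) by rewrite ler_wpM2l.
have h3 : 0 <= (s - s') * F by rewrite mulr_ge0.
have h4 : 0 <= (s - s') * s * V by rewrite !mulr_ge0.
lra.
Qed.

Lemma error_arith (R : realFieldType) (h a b rho l k k' E : R) :
  0 <= rho -> l <= rho ^+ 2 * E -> k <= rho * k' -> k' <= E ->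
  - (h * a) * (- (h * a) * l) + h * b * (h * b * k) <=
  (h ^+ 2 * a ^+ 2 * rho ^+ 2 + h ^+ 2 * b ^+ 2 * rho) * E.
Proof.
move=> rho0 lE kk' k'E.
have h1 : (h * a) ^+ 2 * l <= (h * a) ^+ 2 * (rho ^+ 2 * E) by rewrite ler_wpM2l ?sqr_ge0.
have h2 : (h * b) ^+ 2 * k <= (h * b) ^+ 2 * (rho * E).
  by rewrite ler_wpM2l ?sqr_ge0// (le_trans kk')// ler_wpM2l.
lra.
Qed.

Lemma dual_var_arith (R : comPzRingType) (V : lmodType R) (a b c k1 k2 : V) (s t : R) :
  a + s *: (k1 + k2) + t *: c = a + t *: b + s *: k1 + t *: (c - b) + s *: k2.
Proof.
rewrite scalerDr scalerBr -!addrA; congr (_ + _).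
by rewrite [RHS]addrCA; congr (_ + _); rewrite [RHS]addrCA addNKr addrC.
Qed.

Lemma primal_var_arith (R : fieldType) (V : lmodType R) (X lx le v kg kp : V) (a b h : R) :
  b != 0 -> X - h *: (a *: (lx + le) + b *: v + kg) =
  X - h *: (a *: lx + b *: (v + b^-1 *: kp) + (kg - kp)) + - (h * a) *: le.
Proof.
move=> b0; rewrite -[RHS]addrA; congr (_ + _).
rewrite scaleNr -opprD -scalerA -scalerDr; congr (- (_ *: _)).
rewrite !scalerDr scalerA divff// scale1r -!addrA; congr (_ + _).
by rewrite addrCA; congr (_ + _); rewrite [RHS]addrCA addNKr addrC.
Qed.

(** * Contraction of the Lyapunov function in one step *)

Section OneStep.
Context {R : realType} {n d : nat} (A : 'M[R]_n).
Variables (f : 'I_n -> 'rV[R]_d -> R) (Lf nu fstar alpha beta eta teps : R).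
Variable (Q : 'M[R]_n).
Local Notation L := (laplacian A).
Local Notation rho := (spectral_radius (laplacian A)).
Local Notation rho2 := (smallest_pos_eigenvalue (laplacian A)).
Local Notation u := (const_mx 1 : 'rV[R]_n).
Local Notation K := (@centering R n).

Definition grad_mx (X : 'M[R]_(n, d)) : 'M[R]_(n, d) :=
  \matrix_i gradient (f i) (row i X).

Definition mean_grad_mx (X : 'M[R]_(n, d)) := grad_mx (u^T *m mx_mean X).

Definition gap (z : 'rV[R]_d) : R := \sum_i f i z - n%:R * fstar.

(** At a stationary consensus beta v balances the centred gradients, so this measures the deviation
    of [v] from its moving target, with [Q] a pseudo-inverse of L. *)
Definition dual_var (x v : 'M[R]_(n, d)) := Q *m (v + beta^-1 *: (K *m mean_grad_mx x)).

Definition lyap (x v : 'M[R]_(n, d)) : R :=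
  quad_lyap L alpha beta (K *m x) (dual_var x v) + gap (mx_mean x).

Hypothesis n2 : (2 <= n)%N.
Hypothesis Awt : weighted_adjacency A.
Hypothesis Aconn : connected_graph A.
Hypothesis Lf0 : 0 < Lf.
Hypothesis df : forall i z, differentiable (f i) z.
Hypothesis Lip : forall i z z',
  norm2 (gradient (f i) z - gradient (f i) z') <= Lf * norm2 (z - z').
Hypothesis gap_ge0 : forall z, 0 <= gap z.
Hypothesis nu0 : 0 < nu.
Hypothesis PL : forall z, 2 * nu * gap z <=
  n%:R * ip (mx_mean (grad_mx (u^T *m z))) (mx_mean (grad_mx (u^T *m z))).
Hypothesis b0 : 0 < beta.
Hypothesis ba : beta <= alpha.
Hypothesis c4 : 4 <= (1 + alpha / beta) * rho2.
Hypothesis e0 : 0 < eta.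
Hypothesis eps1_gt : 0 < eps1 alpha beta Lf rho2 - eta * teps2 alpha beta Lf rho.
Hypothesis eps3_gt : 0 < eps3 beta rho2 - eta * teps4 beta rho rho2.
Hypothesis eps5_gt : 0 < eps5 alpha beta Lf rho2 - eta * eps6 alpha beta Lf rho2.
Hypothesis QP : forall m (x : 'M[R]_(n, m)), u *m x = 0 ->
  L *m (Q *m x) = x /\ u *m (Q *m x) = 0.

Let n0 : (0 < n)%N := ltnW n2.

(** Such a [w] equals L (Q w), so the last bound of [laplacian_spectral] applies to Q w. *)
Lemma coercive m (w : 'M[R]_(n, m)) : u *m w = 0 -> rho2 * ip w w <= ip w (L *m w).
Proof.
move=> /QP[wE _]; have [_ _ _ _] := laplacian_spectral Awt Aconn n2 (Q *m w).
by rewrite wE.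
Qed.

Lemma laplacian_centering : L *m K = L.
Proof.
rewrite mulmxBr mulmx1 -scalemxAr mulmxA.
have -> : L *m u^T = 0.
  by rewrite -[L](laplacian_sym Awt) -trmx_mul ones_laplacian// trmx0.
by rewrite mul0mx scaler0 subr0.
Qed.

(** The difference of the two sides has zero mean and is killed by L, so coercivity makes it
    vanish. *)
Lemma pinv_laplacian m (w : 'M[R]_(n, m)) : Q *m (L *m w) = K *m w.
Proof.
have uLw : u *m (L *m w) = 0 by rewrite mulmxA ones_laplacian// mul0mx.
have [LQ uQ] := QP uLw.
pose r := Q *m (L *m w) - K *m w.
have ur : u *m r = 0 by rewrite mulmxBr uQ mulmxA ones_centering// mul0mx subr0.
have Lr : L *m r = 0 by rewrite mulmxBr LQ mulmxA laplacian_centering subrr.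
have := coercive ur; rewrite Lr [leRHS]ipC ip0l pmulr_rle0; last first.
  exact: laplacian_rho2_gt0.
move=> rr; apply/eqP; rewrite -subr_eq0 -/r; apply/eqP/ip_eq0.
by apply/eqP; rewrite eq_le rr ip_ge0.
Qed.

Lemma dual_varP x v : u *m v = 0 ->
  L *m dual_var x v = v + beta^-1 *: (K *m mean_grad_mx x) /\ u *m dual_var x v = 0.
Proof.
move=> uv; apply: QP; rewrite mulmxDr uv add0r -scalemxAr mulmxA.
by rewrite ones_centering// mul0mx scaler0.
Qed.

Lemma lyap_ge x v : u *m v = 0 ->
  3 / 8 * ip (K *m x) (K *m x) + gap (mx_mean x) <= lyap x v.
Proof.
move=> uv; rewrite lerD2r; apply: (quad_lyap_ge (rho2 := rho2)) => //.
- by rewrite addr_ge0// divr_ge0 ?ltW// (lt_le_trans b0).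
- by apply: coercive; case: (dual_varP x uv).
Qed.

(** Sum the smoothness bounds over the agents and polarise 2 <gm, g0> = |gm|^2 + |g0|^2 - |gm -
    g0|^2. *)
Lemma gap_step x z : let gm := mx_mean (grad_mx x) in
  let g0 := mx_mean (mean_grad_mx x) in
  z = - eta *: gm ->
  gap (mx_mean x + z) <= gap (mx_mean x) +
    eta / 2 * (n%:R * ip (gm - g0) (gm - g0)) + eta ^+ 2 * Lf / 2 * (n%:R * ip gm gm)
    - eta / 2 * (n%:R * ip gm gm) - eta / 2 * (n%:R * ip g0 g0).
Proof.
move=> gm g0 zE; set m := mx_mean x.
have : \sum_i f i (m + z) <= \sum_i (f i m + ip (gradient (f i) m) z + Lf / 2 * ip z z).
  by apply: ler_sum => i _; exact: smooth_upper_bound.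
rewrite !big_split/= sumr_const card_ord -(mulr_natl (_ * _)).
have sumE : \sum_i ip (gradient (f i) m) z = n%:R * ip g0 z.
  have -> : g0 = n%:R^-1 *: \sum_i gradient (f i) m.
    congr (_ *: _); apply/rowP => j; rewrite ones_mulmxE summxE.
    by apply: eq_bigr => i _; rewrite -[in RHS](row_ones_mulmx m i) !mxE.
  rewrite ipZl mulrA divff ?mul1r ?pnatr_eq0 -?lt0n//.
  by rewrite (big_morph (fun w => ip w z) (fun a b => ipDl a b z) (ip0l z)).
rewrite sumE; clearbody gm g0; have -> : ip z z = eta ^+ 2 * ip gm gm by rewrite zE ipZl ipZr mulrA mulrNN -expr2.
have -> : ip g0 z = - eta * ip gm g0 by rewrite zE ipZr; congr (_ * _); exact: ipC.
clearbody m; rewrite !ip_lin (ipC g0 gm) /gap; lra.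
Qed.

Lemma mean_grad_lip x y :
  ip (mean_grad_mx x - mean_grad_mx y) (mean_grad_mx x - mean_grad_mx y) <=
  Lf ^+ 2 * (n%:R * ip (mx_mean x - mx_mean y) (mx_mean x - mx_mean y)).
Proof.
rewrite -ip_ones mulmxBr ip_rows [in leRHS]ip_rows mulr_sumr; apply: ler_sum => i _.
rewrite !raddfB/= !rowK !row_ones_mulmx; exact: lip_gradient_sqr.
Qed.

Lemma grad_lip x :
  ip (grad_mx x - mean_grad_mx x) (grad_mx x - mean_grad_mx x) <=
  Lf ^+ 2 * ip (K *m x) (K *m x).
Proof.
rewrite centeringE ip_rows [in leRHS]ip_rows mulr_sumr; apply: ler_sum => i _.
rewrite !raddfB/= !rowK !row_ones_mulmx; exact: lip_gradient_sqr.
Qed.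

                                                                                 
                                                                            
(** Adding [quad_lyap_descent] to [gap_step] leaves a decrease of at least eta times the minimum in
    [teps12] times |Kx|^2 + <z, L z> + gap, and [eps11] times that sum dominates the Lyapunov
    value. *)
Lemma lyap_step_exact x v (x' y : 'M[R]_(n, d)) (z := dual_var x v) :
  u *m v = 0 ->
  mx_mean x' = mx_mean x - eta *: mx_mean (grad_mx x) ->
  L *m y = beta^-1 *: (K *m (mean_grad_mx x' - mean_grad_mx x)) -> u *m y = 0 ->
  quad_lyap L alpha beta
    (K *m x - eta *: (alpha *: (L *m (K *m x)) + beta *: (L *m z)
                      + K *m (grad_mx x - mean_grad_mx x)))
    (z + (eta * beta) *: (K *m x) + y) + gap (mx_mean x')
  <= (1 - teps0 alpha beta eta nu Lf rho rho2) * lyap x v.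
Proof.
move=> uv mx'E Ly uy.
have nuh : nu / 2 <= nu by rewrite ler_pdivrMr// ler_peMr ?ler1n// ltW.
have Lsym := laplacian_sym Awt.
have r20 := laplacian_rho2_gt0 Awt Aconn n2.
have [zE uz] := dual_varP x uv.
set gm := mx_mean (grad_mx x); set g0 := mx_mean (mean_grad_mx x).
set G := n%:R * ip gm gm; set G0 := n%:R * ip g0 g0.
set D := n%:R * ip (gm - g0) (gm - g0).
have gs : gap (mx_mean x') <= gap (mx_mean x) + eta / 2 * D + eta ^+ 2 * Lf / 2 * G
    - eta / 2 * G - eta / 2 * G0.
  by rewrite mx'E -scaleNr; exact: (@gap_step x (- eta *: gm) erefl).
set X := K *m x; set h := K *m _.
have uX : u *m X = 0 by rewrite mulmxA ones_centering// mul0mx.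
have [_ _ _ s4 _] := laplacian_spectral Awt Aconn n2 X.
have [_ _ s3 _ _] := laplacian_spectral Awt Aconn n2 z.
have [_ t2 _ _ _] := laplacian_spectral Awt Aconn n2 y.
(* By Pythagoras the gradient disagreement splits into its centred part [h] and its mean part [D],
   so a single Lipschitz bound controls both. *)
have hD : ip h h + D <= Lf ^+ 2 * ip X X.
  apply: le_trans (grad_lip x); rewrite [leRHS]ip_centering// -/h.
  by rewrite mx_meanD -scaleN1r mx_meanZ scaleN1r.
(* The drift [y] comes from the gradients at the old and the new mean, and the mean moves by eta
   times the mean gradient. *)
have LyG : beta ^+ 2 * ip (L *m y) (L *m y) <= eta ^+ 2 * Lf ^+ 2 * G.
  have bK c : beta ^+ 2 * (beta^-1 * (beta^-1 * c)) = c by field; rewrite gt_eqF.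
  rewrite Ly ipZl ipZr bK; apply: le_trans (ip_centering_le n0 _) _.
  apply: le_trans (mean_grad_lip _ _) _.
  rewrite mx'E -/gm addrAC subrr add0r ipNl ipNr ipZl ipZr opprK -/G.
  have -> : n%:R * (eta * (eta * ip gm gm)) = eta ^+ 2 * G by rewrite /G mulrCA mulrA mulrCA expr2 !mulrA.
  by rewrite mulrCA mulrA.
have b2 : 0 < beta ^+ 2 by rewrite exprn_gt0.
have := @quad_lyap_descent R n d L alpha beta eta Lf rho rho2 D G X z y h Lsym
  (laplacian_ge0 Awt (m := d)) b0 ba r20 e0.
move=> /(_ _ (coercive uX) s4 (coercive uz) s3 _ _ LyG hD).
have -> : 0 <= D by rewrite mulr_ge0 ?ler0n ?ip_ge0.
have yLyG : beta ^+ 2 * rho2 * ip y (L *m y) <= eta ^+ 2 * Lf ^+ 2 * G.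
  by rewrite -mulrA; apply: le_trans LyG; rewrite ler_pM2l.
have yyG : beta ^+ 2 * rho2 ^+ 2 * ip y y <= eta ^+ 2 * Lf ^+ 2 * G.
  apply: le_trans yLyG; rewrite expr2 mulrA -[leLHS]mulrA ler_pM2l ?mulr_gt0//.
  exact: coercive.
move=> /(_ isT yLyG yyG) desc.
have GG : 0 <= eta * (eps5 alpha beta Lf rho2 - eta * eps6 alpha beta Lf rho2) * G.
  by rewrite mulr_ge0 ?mulr_ge0 ?ler0n ?ip_ge0 ?ltW.
have G'0 : 0 <= eta * G by rewrite !mulr_ge0 ?ler0n ?ip_ge0 ?ltW.
have U0 : 0 <= ip z (L *m z) := laplacian_ge0 Awt z.
have X0 : 0 <= ip X X := ip_ge0 X.
set mm := Num.min (eps1 alpha beta Lf rho2 - eta * teps2 alpha beta Lf rho)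
  (Num.min (eps3 beta rho2 - eta * teps4 beta rho rho2) (nu / 2)).
have mm0 : 0 < mm by rewrite !lt_min eps1_gt eps3_gt divr_gt0.
have mm1 : mm <= eps1 alpha beta Lf rho2 - eta * teps2 alpha beta Lf rho.
  by rewrite ge_min lexx.
have mm3 : mm <= eps3 beta rho2 - eta * teps4 beta rho rho2.
  by rewrite !ge_min lexx orbT.
have mmn : mm <= nu / 2 by rewrite !ge_min lexx !orbT.
have M1 : eta * mm * ip X X <= eta * (eps1 alpha beta Lf rho2 - eta * teps2 alpha beta Lf rho) * ip X X.
  by rewrite ler_wpM2r// ler_pM2l.
have M3 : eta * mm * ip z (L *m z) <= eta * (eps3 beta rho2 - eta * teps4 beta rho rho2) * ip z (L *m z).
  by rewrite ler_wpM2r// ler_pM2l.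
have gap0 := gap_ge0 (mx_mean x).
(* The Polyak-Lojasiewicz condition pays for the decay of the gap with the term in [G0] left by
   [gap_step]. *)
have M2 : eta * mm * gap (mx_mean x) <= eta / 2 * G0.
  have := PL (mx_mean x); rewrite -/(mean_grad_mx x) -/g0 -/G0 => pl.
  have g1 : mm * gap (mx_mean x) <= nu / 2 * gap (mx_mean x) by rewrite ler_wpM2r.
  have -> : eta / 2 * G0 = eta * (G0 / 2) by rewrite -mulrA (mulrC _ G0).
  rewrite -mulrA ler_pM2l//.
  rewrite ler_pdivlMr//; apply: le_trans pl; rewrite mulrC -mulrA ler_pM2l//.
  by apply: le_trans g1 _; rewrite ler_wpM2r.
have a0 : 0 < alpha by exact: lt_le_trans ba.
have up := @quad_lyap_le R n d L alpha beta rho2 X z a0 b0 r20 (coercive uz).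
set e11 := eps11 alpha beta rho2 in up.
(* From beta <= alpha; hence the gap too is dominated after scaling by [eps11]. *)
have e11_1 : 1 <= e11.
  rewrite /e11 /eps11 le_max; apply/orP; left.
  by rewrite ler_wpDl ?invr_ge0 ?ler0n// ler_pdivlMr// mul1r.
have lyap_le : lyap x v <= e11 * (ip X X + ip z (L *m z) + gap (mx_mean x)).
  rewrite /lyap -/X -/z [leRHS]mulrDr lerD//.
  by rewrite -[leLHS]mul1r ler_wpM2r.
have e11_0 : 0 < e11 by exact: lt_le_trans e11_1.
have : teps0 alpha beta eta nu Lf rho rho2 * lyap x v <=
    eta * mm * (ip X X + ip z (L *m z) + gap (mx_mean x)).
  rewrite /teps0 /teps12 -/mm -/e11 -mulrA ler_pM2l ?mulr_gt0// mulrC.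
  by rewrite ler_pdivrMr// mulrC.
rewrite mulrBl mul1r {2}/lyap -/X -/z.
clearbody mm G G0 D; exact: (@descent_arith R) desc gs GG G'0 M1 M3 M2.
Qed.

(** The error adds -eta alpha L e and eta beta K e to the two arguments of the quadratic part and
    nothing to the mean; [quad_lyapD_le] separates it from the exact step. *)
Lemma lyap_step : 0 < teps -> teps < 1 -> teps < teps0 alpha beta eta nu Lf rho rho2 ->
  exists2 Ce : R, 0 <= Ce & forall x v e : 'M[R]_(n, d), u *m v = 0 ->
    lyap (x - eta *: (alpha *: (L *m (x + e)) + beta *: v + grad_mx x))
         (v + (eta * beta) *: (L *m (x + e)))
    <= (1 - teps) * lyap x v + Ce * ip e e.
Proof.
move=> t0 t1 tlt; have a0 : 0 < alpha by exact: lt_le_trans ba.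
have r20 := laplacian_rho2_gt0 Awt Aconn n2.
have rho0 := laplacian_rho_ge0 Awt Aconn n2.
(* The whole slack in the rate becomes the Young parameter. *)
pose t := teps0 alpha beta eta nu Lf rho rho2 - teps.
have tp : 0 < t by rewrite subr_gt0.
have e11_0 : 0 <= eps11 alpha beta rho2.
  rewrite /eps11 le_max; apply/orP; left.
  by rewrite addr_ge0// divr_ge0// ltW.
exists ((1 + t^-1) * (eps11 alpha beta rho2 *
   (eta ^+ 2 * alpha ^+ 2 * rho ^+ 2 + eta ^+ 2 * beta ^+ 2 * rho))).
  have := (sqr_ge0 eta, sqr_ge0 alpha, sqr_ge0 beta, sqr_ge0 rho) => -[[[? ?] ?] ?].
  rewrite mulr_ge0//; first by rewrite addr_ge0// invr_ge0 ltW.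
  by rewrite mulr_ge0// addr_ge0// mulr_ge0// mulr_ge0.
move=> x v e uv; have [zE uz] := dual_varP x uv.
set x' := x - _; set v' := v + _.
have uL m (w : 'M[R]_(n, m)) : u *m (L *m w) = 0.
  by rewrite mulmxA ones_laplacian// mul0mx.
have uK m (w : 'M[R]_(n, m)) : u *m (K *m w) = 0.
  by rewrite mulmxA ones_centering// mul0mx.
have LK m (w : 'M[R]_(n, m)) : L *m w = L *m (K *m w).
  by rewrite mulmxA laplacian_centering.
(* Both [v] and the range of L have zero mean, so the mean follows the averaged gradient regardless
   of [e]. *)
have mx'E : mx_mean x' = mx_mean x - eta *: mx_mean (grad_mx x).
  rewrite /x'; move: (x + e) => w.
  rewrite mx_meanD -scaleNr mx_meanZ scaleNr; congr (_ - eta *: _).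
  by rewrite /mx_mean !mulmxDr -!scalemxAr uL uv !scaler0 !add0r.
set z := dual_var x v in zE uz.
pose y := Q *m (beta^-1 *: (K *m (mean_grad_mx x' - mean_grad_mx x))).
have [Ly uy] : L *m y = beta^-1 *: (K *m (mean_grad_mx x' - mean_grad_mx x)) /\ u *m y = 0.
  by apply: QP; rewrite -scalemxAr uK scaler0.
(* Since Q L = K, the dual update becomes a shift by the centred primal stack; [y] accounts for the
   change of the gradient target. *)
have z'E : dual_var x' v' = (z + (eta * beta) *: (K *m x) + y) + (eta * beta) *: (K *m e).
  have QD (a b : 'M[R]_(n, d)) t' : Q *m (a + t' *: b) = Q *m a + t' *: (Q *m b).
    by rewrite mulmxDr scalemxAr.
  rewrite /dual_var /v' 2!QD pinv_laplacian (mulmxDr K).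
  rewrite /z /dual_var QD /y -scalemxAr (mulmxBr K) (mulmxBr Q).
  exact: dual_var_arith.
have x'E : K *m x' = (K *m x - eta *: (alpha *: (L *m (K *m x)) + beta *: (L *m z)
     + K *m (grad_mx x - mean_grad_mx x))) + - (eta * alpha) *: (L *m e).
  have KZ (a : 'M[R]_(n, d)) t' : K *m (t' *: a) = t' *: (K *m a) by rewrite scalemxAr.
  rewrite /x' (mulmxBr K x) KZ 2!(mulmxDr K) 2!KZ.
  rewrite (centering_id (uL _ _)) (centering_id uv) zE (mulmxDr L) (LK _ x) (mulmxBr K).
  by apply: primal_var_arith; rewrite gt_eqF.
have uX' : u *m (- (eta * alpha) *: (L *m e)) = 0 by rewrite -scalemxAr uL scaler0.
have uZ' : u *m ((eta * beta) *: (K *m e)) = 0 by rewrite -scalemxAr uK scaler0.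
have exact := lyap_step_exact uv mx'E Ly uy; rewrite -/z in exact.
have c0 : 0 <= 1 + alpha / beta by rewrite addr_ge0// divr_ge0 ?ltW.
set X1 := K *m x - _ in exact x'E; set z1 := z + _ + y in exact z'E.
have uz1 : u *m z1 = 0.
  by rewrite /z1 !mulmxDr uz uy -scalemxAr uK scaler0 !addr0.
have split_err : quad_lyap L alpha beta (X1 + - (eta * alpha) *: (L *m e))
    (z1 + (eta * beta) *: (K *m e)) <= (1 + t) * quad_lyap L alpha beta X1 z1
    + (1 + t^-1) * quad_lyap L alpha beta (- (eta * alpha) *: (L *m e)) ((eta * beta) *: (K *m e)).
  apply: (quad_lyapD_le _ _ (laplacian_sym Awt) tp c0 c4) => w ->; apply: coercive.
  by rewrite mulmxBr -scalemxAr uz1 scaler0 uZ' subr0.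
have err := @quad_lyap_le R n d L alpha beta rho2 (- (eta * alpha) *: (L *m e))
   ((eta * beta) *: (K *m e)) a0 b0 r20 (coercive uZ').
have [_ _ _ s5 _] := laplacian_spectral Awt Aconn n2 e.
have [s1 _ _ _ _] := laplacian_spectral Awt Aconn n2 (K *m e).
have Ke := ip_centering_le n0 e.
have V0 : 0 <= lyap x v.
  apply: le_trans (lyap_ge x uv); rewrite addr_ge0// mulr_ge0 ?ip_ge0// divr_ge0//.
have gap' := gap_ge0 (mx_mean x').
have errE : quad_lyap L alpha beta (- (eta * alpha) *: (L *m e)) ((eta * beta) *: (K *m e)) <=
    eps11 alpha beta rho2 * (eta ^+ 2 * alpha ^+ 2 * rho ^+ 2 + eta ^+ 2 * beta ^+ 2 * rho) * ip e e.
  apply: le_trans err _; rewrite -mulrA ler_wpM2l//.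
  rewrite -scalemxAr !ipZl !ipZr; exact: error_arith rho0 s5 s1 Ke.
rewrite [leLHS]/lyap x'E z'E.
have t'0 : 0 <= 1 + t^-1 by rewrite addr_ge0// invr_ge0 ltW.
exact: (lyap_step_arith split_err exact errE t'0 (ltW tp) (ltW (lt_trans t0 tlt)) V0 gap').
Qed.

End OneStep.

                     

(** * The algorithm in matrix form *)

Section Trajectory.
Context {R : realType} {n d : nat} (L : 'M[R]_n).
Variables (grad : 'I_n -> 'rV[R]_d -> 'rV[R]_d) (alpha beta eta : R) (s : nat -> R)
  (cmp : nat -> 'I_n -> 'rV[R]_d -> 'rV[R]_d) (x0 : 'I_n -> 'rV[R]_d)
  (x xhat y v q : nat -> 'I_n -> 'rV[R]_d).
Hypothesis traj : compressed_primal_dual L grad alpha beta eta s cmp x0 x xhat y v q.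

Definition stack (z : 'I_n -> 'rV[R]_d) : 'M[R]_(n, d) := \matrix_i z i.

Lemma row_mul_stack (z : 'I_n -> 'rV[R]_d) i :
  row i (L *m stack z) = \sum_j L i j *: z j.
Proof.
apply/rowP => k; rewrite !mxE summxE; apply: eq_bigr => j _.
by rewrite !mxE.
Qed.

(** By induction: [y] receives the increments of [xhat] minus L applied to them. *)
Lemma cpd_disagreement k i : xhat k i - y k i = row i (L *m stack (xhat k)).
Proof.
rewrite row_mul_stack; elim: k i => [|k IH] i.
  rewrite (cpd_xhat traj) (cpd_y traj) /= !add0r opprB addrC subrK scaler_sumr.
  apply: eq_bigr => j _; rewrite (cpd_xhat traj) /= add0r !scalerA mulrC//.
rewrite (cpd_xhat traj) (cpd_y traj) /=.
have -> : y k i = xhat k i - \sum_j L i j *: xhat k j by rewrite -IH opprB addrC subrK.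
under [in RHS]eq_bigr do rewrite (cpd_xhat traj) /= scalerDr scalerA mulrC -scalerA.
rewrite big_split/= -scaler_sumr.
apply/rowP => j; rewrite !mxE; ring.
Qed.

Lemma cpd_qE k i : q k i = cmp k i ((s k)^-1 *: (x k i - Defs.prev (xhat^~ i) k)).
Proof. by case: k => [|k]; rewrite ?(cpd_q_init traj) ?(cpd_q traj) /= ?subr0. Qed.

(** As s_k z = x_k - xhat_{k-1}, the estimation error is the compression error at z rescaled by s_k,
    hence small with s_k however large z is. *)
Lemma cpd_error k i : s k != 0 ->
  let z := (s k)^-1 *: (x k i - Defs.prev (xhat^~ i) k) in
  xhat k i - x k i = s k *: (cmp k i z - z).
Proof.
move=> s0 z; rewrite (cpd_xhat traj) cpd_qE -/z scalerBr /z scalerA divff//.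
rewrite scale1r; apply/rowP => j; rewrite !mxE; ring.
Qed.

Lemma cpd_stack_x k (X := stack (x k)) (e := stack (fun i => xhat k i - x k i)) :
  stack (x k.+1) = X - eta *: (alpha *: (L *m (X + e)) + beta *: stack (v k)
    + \matrix_i grad i (row i X)).
Proof.
have XeE : X + e = stack (xhat k).
  by apply/matrixP => i j; rewrite !mxE addrC subrK.
apply/row_matrixP => i; rewrite rowK (cpd_x traj) cpd_disagreement XeE.
move: (L *m stack (xhat k)) => w; apply/rowP => j.
by rewrite !mxE rowK; ring.
Qed.

Lemma cpd_stack_v k (X := stack (x k)) (e := stack (fun i => xhat k i - x k i)) :
  stack (v k.+1) = stack (v k) + (eta * beta) *: (L *m (X + e)).
Proof.
have XeE : X + e = stack (xhat k).
  by apply/matrixP => i j; rewrite !mxE addrC subrK.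
apply/row_matrixP => i; rewrite rowK (cpd_v traj) cpd_disagreement XeE.
by rewrite linearD/= linearZ/= rowK.
Qed.

Lemma cpd_dual_mean k : (const_mx 1 : 'rV[R]_n) *m L = 0 ->
  (const_mx 1 : 'rV[R]_n) *m stack (v k) = 0.
Proof.
move=> uL; elim: k => [|k IH].
  rewrite (_ : stack _ = 0) ?mulmx0//.
  by apply/row_matrixP => i; rewrite rowK (cpd_v_init traj) row0.
by rewrite cpd_stack_v mulmxDr IH add0r -scalemxAr mulmxA uL mul0mx scaler0.
Qed.

End Trajectory.

(** Truncated subtraction in the exponent is harmless: j < k throughout, and the sum is empty for k
    = 0. *)
Lemma geometric_recursion {R : realFieldType} (r c : R) (V e : nat -> R) :
  0 <= r -> (forall k, V k.+1 <= r * V k + c * e k) ->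
  forall k, V k <= r ^+ k * V 0%N + \sum_(j < k) c * r ^+ (k.-1 - j) * e j.
Proof.
move=> r0 rec; elim=> [|k IH]; first by rewrite big_ord0 addr0 mul1r.
apply: le_trans (rec k) _; rewrite big_ord_recr/= subnn mulr1 addrA lerD2r.
apply: le_trans (ler_wpM2l r0 IH) _; rewrite mulrDr mulrA -exprS lerD2l.
rewrite mulr_sumr le_eqVlt; apply/orP; left; apply/eqP; apply: eq_bigr => j _.
have -> : (k - j)%N = (k.-1 - j).+1.
  by case: (k) j => [[]//|m] j /=; rewrite subSn// -ltnS.
by rewrite exprS; ring.
Qed.

(** The sum times r - g is r^k - g^k. *)
Lemma geometric_convolution_le {R : realFieldType} (r g : R) k : 0 <= g -> g < r ->
  \sum_(j < k) r ^+ (k.-1 - j) * g ^+ j <= r ^+ k / (r - g).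
Proof.
move=> g0 gr; have rg : 0 < r - g by rewrite subr_gt0.
have E : (r - g) * \sum_(j < k) r ^+ (k.-1 - j) * g ^+ j = r ^+ k - g ^+ k.
  by rewrite subrXX; congr (_ * _); apply: eq_bigr => j _; rewrite -subn1 -subnDA add1n.
by rewrite ler_pdivlMr// mulrC E lerBlDr lerDl exprn_ge0.
Qed.

                                   

(** * Measurability of vector maps and expectation of affine bounds *)

Section VectorMeasurability.
Context {R : realType} {d : nat} {dS : measure_display} {S : measurableType dS}.
Implicit Types (g h : S -> 'rV[R]_d).

(** Closure under vector operations reduces to real-valued functions; the next two lemmas make this
    equivalent to Borel measurability. *)
Definition coord_measurable h :=
  forall j, measurable_fun [set: S] (fun s => h s 0 j).

Lemma coord_measurable_rV h : coord_measurable h ->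
  measurable_fun [set: S] (h : S -> borel_rV R d).
Proof. exact: measurable_rV_coord. Qed.

Lemma rV_coord_measurable h :
  measurable_fun [set: S] (h : S -> borel_rV R d) -> coord_measurable h.
Proof.
by move=> mh j; exact: (measurableT_comp (measurable_coord_rV j) mh).
Qed.

Lemma coord_measurable_comp (F : 'rV[R]_d -> 'rV[R]_d) h :
  (forall j, continuous (fun z => F z 0 j)) ->
  coord_measurable h -> coord_measurable (F \o h).
Proof.
move=> cF /coord_measurable_rV mh j.
exact: (measurableT_comp (@continuous_measurable_rV _ _ (fun z => F z 0 j) (cF j)) mh).
Qed.

Lemma coord_measurable_cst (z : 'rV[R]_d) : coord_measurable (fun=> z).
Proof. by move=> j; exact: measurable_cst. Qed.

Lemma coord_measurableD g h : coord_measurable g -> coord_measurable h ->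
  coord_measurable (fun s => g s + h s).
Proof.
move=> mg mh j; under eq_fun do rewrite mxE.
exact: measurable_funD.
Qed.

Lemma coord_measurableZ (a : R) h : coord_measurable h ->
  coord_measurable (fun s => a *: h s).
Proof.
move=> mh j; under eq_fun do rewrite mxE.
exact: measurable_funM.
Qed.

Lemma coord_measurableB g h : coord_measurable g -> coord_measurable h ->
  coord_measurable (fun s => g s - h s).
Proof.
move=> mg mh; under [X in coord_measurable X]eq_fun do rewrite -scaleN1r.
exact/coord_measurableD/coord_measurableZ.
Qed.

Lemma coord_measurable_sum m (h : 'I_m -> S -> 'rV[R]_d) :
  (forall i, coord_measurable (h i)) -> coord_measurable (fun s => \sum_i h i s).
Proof.
move=> mh j; under eq_fun do rewrite summxE.
by apply: measurable_sum => i; exact: mh.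
Qed.

Lemma measurable_ip h : coord_measurable h ->
  measurable_fun [set: S] (fun s => ip (h s) (h s)).
Proof.
move=> mh; under eq_fun do rewrite ipE big_ord1.
by apply: measurable_sum => j; exact: measurable_funM.
Qed.

Lemma measurable_pnorm (p : R) h : coord_measurable h ->
  measurable_fun [set: S] (fun s => pnorm p (h s)).
Proof.
move=> mh; rewrite /pnorm.
apply: (measurableT_comp (measurable_powR p^-1)); apply: measurable_sum => j.
exact: (measurableT_comp (measurable_powR p) (measurableT_comp (@normr_measurable R setT) (mh j))).
Qed.

End VectorMeasurability.

Lemma expectation_affine_le {R : realType} {dO : measure_display}
    {Omega : measurableType dO} (P : probability Omega R) (I : finType)
    (F : Omega -> R) (g : I -> Omega -> R) (a : R) (c b : I -> R) :
  measurable_fun setT F -> (forall i, measurable_fun setT (g i)) ->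
  (forall w, 0 <= F w) -> (forall i w, 0 <= g i w) -> 0 <= a -> (forall i, 0 <= c i) ->
  (forall w, F w <= a + \sum_i c i * g i w) ->
  (forall i, \int[P]_w (g i w)%:E <= (b i)%:E)%E ->
  ('E_P[F] <= (a + \sum_i c i * b i)%:E)%E.
Proof.
move=> mF mg F0 g0 a0 c0 Fle gb; rewrite unlock.
have mcg i : measurable_fun setT (fun w => (c i)%:E * (g i w)%:E)%E.
  by apply: measurable_funeM; exact/measurable_EFinP.
have cg0 i w : (0 <= (c i)%:E * (g i w)%:E)%E by rewrite mule_ge0// lee_fin.
apply: (@le_trans _ _ (\int[P]_w (a%:E + \sum_i (c i)%:E * (g i w)%:E))%E).
  apply: ge0_le_integral => //.
  - by move=> w _; rewrite lee_fin.
  - exact/measurable_EFinP.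
  - by apply: emeasurable_funD => //; exact: emeasurable_sum.
  move=> w _; under eq_bigr do rewrite -EFinM.
  by rewrite sumEFin -EFinD lee_fin.
rewrite ge0_integralD//; last 2 first.
  - by move=> w _; exact: sume_ge0.
  - exact: emeasurable_sum.
have -> : (\int[P]_w a%:E = a%:E)%E.
  by rewrite integral_cst// [X in (_ * X)%E](_ : _ = 1%E) ?mule1//; exact: probability_setT.
rewrite EFinD leeD2l//.
rewrite ge0_integral_sum// -sumEFin; apply: lee_sum => i _.
rewrite ge0_integralZl_EFin//; last exact/measurable_EFinP.
  by rewrite EFinM lee_wpmul2l// lee_fin.
by move=> w _; rewrite lee_fin.
Qed.

(** * Adaptedness and the size of the compression error *)

Section Seeds.
Context {R : realType} {n d : nat} {dT dO : measure_display}
  {T : measurableType dT} (PT : probability T R)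
  (Q : T -> 'rV[R]_d -> 'rV[R]_d) (p C : R)
  {Omega : measurableType dO} (P : probability Omega R)
  (xi : nat * 'I_n -> Omega -> T).
Hypothesis p1 : 1 <= p.
Hypothesis mQ : compressor_measurable Q.
Hypothesis QC : compression_error_bounded PT Q p C.
Hypothesis seeds : fresh_seeds PT P xi.

(** Labels of the compressor calls made strictly before step k; the calls (k, i) are not among them,
    which is what freshness needs. *)
Definition past (k : nat) : seq (nat * 'I_n) :=
  [seq (k', i) | k' <- iota 0 k, i <- enum 'I_n].

Lemma mem_past k a : (a \in past k) = (a.1 < k)%N.
Proof.
apply/allpairsP/idP => [[[k' i] [/= k'k _ ->]]|ak].
  by move: k'k; rewrite mem_iota.
by exists a; rewrite mem_iota mem_enum; case: (a) ak.
Qed.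

Lemma past_uniq k : uniq (past k).
Proof.
apply: allpairs_uniq; rewrite ?iota_uniq ?enum_uniq//.
by move=> [? ?] [? ?].
Qed.

Local Notation hist k := (g_sigma_algebraType (cylinders xi (past k))).

Lemma measurable_hist_mono dS (S : measurableType dS) k (h : Omega -> S) :
  measurable_fun [set: hist k] h -> measurable_fun [set: hist k.+1] h.
Proof.
move=> mh _ B mB; have := mh measurableT B mB; rewrite !setTI.
apply: sub_smallest2r; first exact: smallest_sigma_algebra.
move=> _ [E [mE ->]]; exists (fun j => if j \in past k then E j else setT).
split=> [j|]; first by case: ifP.
apply/seteqP; split=> w /= Ew j /=.
  by move=> _; case: ifP => // jk; exact: Ew.
by move=> jk; have := Ew j; rewrite /= jk; apply; move: jk; rewrite /= !mem_past => /ltnW.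
Qed.

Lemma coord_measurable_hist_mono k (h : Omega -> 'rV[R]_d) :
  coord_measurable (h : hist k -> _) -> coord_measurable (h : hist k.+1 -> _).
Proof. by move=> mh j; exact: measurable_hist_mono. Qed.

Lemma coord_measurable_hist k (h : Omega -> 'rV[R]_d) :
  coord_measurable (h : hist k -> _) -> coord_measurable h.
Proof.
move=> mh j; apply: measurable_fun_cylinders (mh j).
by case: seeds.
Qed.

Lemma coord_measurable_compressor k i (z : Omega -> 'rV[R]_d) :
  coord_measurable (z : hist k -> _) ->
  coord_measurable ((fun w => Q (xi (k, i) w) (z w)) : hist k.+1 -> _).
Proof.
move=> mz; apply: rV_coord_measurable.
have mz' : measurable_fun [set: hist k.+1] (z : hist k.+1 -> borel_rV R d).
  by apply: coord_measurable_rV; exact: coord_measurable_hist_mono.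
have mxi : measurable_fun [set: hist k.+1] (xi (k, i) : hist k.+1 -> T).
  by apply: cylinders_coord; rewrite mem_past.
have := measurableT_comp mQ (measurable_fun_pair mxi mz').
exact.
Qed.

(** The argument [z] depends on past seeds only and the seed (k, i) is independent of them, so the
    bound for a fixed argument passes to the random one; d is the price of replacing the p-norm by
    the Euclidean norm. *)
Lemma compression_error_expectation k i (z : Omega -> 'rV[R]_d) (a : R) :
  coord_measurable (z : hist k -> _) ->
  (\int[P]_w (ip (a *: (Q (xi (k, i) w) (z w) - z w)) (a *: (Q (xi (k, i) w) (z w) - z w)))%:E
   <= (a ^+ 2 * (d%:R * C))%:E)%E.
Proof.
move=> mz; case: (seeds) => mxi lawxi indxi.
have a2 : 0 <= a ^+ 2 by exact: sqr_ge0.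
have cmQ : coord_measurable (fun t : T * borel_rV R d => Q t.1 t.2 : 'rV[R]_d).
  exact: rV_coord_measurable.
have cm2 : coord_measurable (fun t : T * borel_rV R d => t.2 : 'rV[R]_d).
  by apply: rV_coord_measurable; exact: measurable_snd.
pose phi (t : T * borel_rV R d) : \bar R :=
  (ip (a *: (Q t.1 t.2 - t.2)) (a *: (Q t.1 t.2 - t.2)))%:E.
apply: (@integral_independent_le _ _ _ _ _ P _ xi mxi indxi _ (borel_rV R d) z PT
  (past k) (k, i) phi).
- exact: past_uniq.
- by rewrite mem_past ltnn.
- exact: lawxi.
- exact: coord_measurable_rV.
- apply/measurable_EFinP/measurable_ip/coord_measurableZ.
  exact: coord_measurableB.
- by move=> t; rewrite lee_fin ip_ge0.
move=> s; rewrite /phi /=.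
have cmQs : coord_measurable (fun t : T => Q t s - s).
  apply: coord_measurableB; last exact: coord_measurable_cst.
  apply: rV_coord_measurable.
  have := measurableT_comp mQ (measurable_fun_pair (@measurable_id _ T setT) (measurable_cst (s : borel_rV R d))).
  exact.
have mpn : measurable_fun [set: T] (fun t => (pnorm p (Q t s - s) ^+ 2)%:E).
  by apply/measurable_EFinP/measurable_funX; exact: measurable_pnorm.
apply: (@le_trans _ _ (\int[PT]_t ((a ^+ 2 * d%:R)%:E * (pnorm p (Q t s - s) ^+ 2)%:E))%E).
  apply: ge0_le_integral => //.
  - by move=> t _; rewrite lee_fin ip_ge0.
  - exact/measurable_EFinP/measurable_ip/coord_measurableZ.
  - exact: measurable_funeM.
  move=> t _; rewrite -EFinM lee_fin ipZl ipZr [leLHS]mulrA -expr2 -[leRHS]mulrA.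
  by rewrite ler_wpM2l// ip_le_pnorm.
rewrite ge0_integralZl_EFin//; last 2 first.
  - by move=> t _; rewrite lee_fin sqr_ge0.
  - by rewrite mulr_ge0.
rewrite mulrA [leRHS]EFinM; apply: lee_wpmul2l; first by rewrite lee_fin mulr_ge0.
by have := QC s; rewrite unlock; exact.
Qed.

Section Adapted.
Variables (L : 'M[R]_n) (grad : 'I_n -> 'rV[R]_d -> 'rV[R]_d) (alpha beta eta : R)
  (s : nat -> R) (x0 : 'I_n -> 'rV[R]_d)
  (x xhat y v q : Omega -> nat -> 'I_n -> 'rV[R]_d).
Hypothesis cgrad : forall i j, continuous (fun z => grad i z 0 j).
Hypothesis traj : forall w, compressed_primal_dual L grad alpha beta eta s
  (fun k i => Q (xi (k, i) w)) x0 (x w) (xhat w) (y w) (v w) (q w).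

(** Induction on k: step k uses only the seeds (k, j) besides the past, and the gradients are
    continuous. *)
Lemma cpd_adapted k : forall i,
  [/\ coord_measurable ((fun w => x w k i) : hist k -> _),
      coord_measurable ((fun w => v w k i) : hist k -> _) &
      coord_measurable ((fun w => Defs.prev ((xhat w)^~ i) k) : hist k -> _)].
Proof.
elim: k => [|k IH] i.
  split; last exact: coord_measurable_cst.
  - under [X in coord_measurable X]eq_fun do rewrite (cpd_x_init (traj _)).
    exact: coord_measurable_cst.
  - under [X in coord_measurable X]eq_fun do rewrite (cpd_v_init (traj _)).
    exact: coord_measurable_cst.
have mxhat j : coord_measurable ((fun w => xhat w k j) : hist k.+1 -> _).
  have [mx mv mp] := IH j.
  under [X in coord_measurable X]eq_fun do rewrite (cpd_xhat (traj _)) (cpd_qE (traj _)).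
  apply: coord_measurableD; first exact: coord_measurable_hist_mono.
  apply: coord_measurableZ; apply: coord_measurable_compressor.
  exact/coord_measurableZ/coord_measurableB.
have mdis : coord_measurable ((fun w => xhat w k i - y w k i) : hist k.+1 -> _).
  under [X in coord_measurable X]eq_fun do rewrite (cpd_disagreement (traj _)) row_mul_stack.
  by apply: coord_measurable_sum => j; exact: coord_measurableZ.
have [/coord_measurable_hist_mono mx /coord_measurable_hist_mono mv _] := IH i.
split; last exact: mxhat.
  under [X in coord_measurable X]eq_fun do rewrite (cpd_x (traj _)).
  apply: coord_measurableB.
    by apply: coord_measurableB => //; exact: coord_measurableZ.
  apply: coord_measurableZ; apply: coord_measurableD; first exact: coord_measurableZ.
  exact: (coord_measurable_comp (@cgrad i) mx).
under [X in coord_measurable X]eq_fun do rewrite (cpd_v (traj _)).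
by apply: coord_measurableD => //; exact: coord_measurableZ.
Qed.

Lemma cpd_x_measurable k i : coord_measurable (fun w => x w k i).
Proof. by have [mx _ _] := cpd_adapted k i; exact: coord_measurable_hist mx. Qed.

Lemma cpd_xhat_measurable k i : coord_measurable (fun w => xhat w k i).
Proof. by have [_ _ mx] := cpd_adapted k.+1 i; exact: coord_measurable_hist mx. Qed.

Lemma cpd_error_expectation k i : s k != 0 ->
  (\int[P]_w (ip (xhat w k i - x w k i) (xhat w k i - x w k i))%:E
    <= (s k ^+ 2 * (d%:R * C))%:E)%E.
Proof.
move=> sk; pose z w := (s k)^-1 *: (x w k i - Defs.prev ((xhat w)^~ i) k).
under eq_integral do rewrite (cpd_error (traj _) i sk).
apply: (@compression_error_expectation k i z).
have [mx _ mp] := cpd_adapted k i.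
exact/coord_measurableZ/coord_measurableB.
Qed.

End Adapted.
End Seeds.

(** * Step-size margins and assembly of the convergence bound *)

Lemma gradient_mean {R : realType} {n d : nat} (f : 'I_n -> 'rV[R]_d -> R) z :
  (forall i z, differentiable (f i) z) ->
  gradient (fun z => n%:R^-1 * \sum_(i < n) f i z) z =
  n%:R^-1 *: \sum_(i < n) gradient (f i) z.
Proof.
move=> df; have -> : (fun z => n%:R^-1 * \sum_(i < n) f i z) =
    n%:R^-1 \*: (\sum_(i < n) f i).
  by apply/funext => y; rewrite /GRing.scale_fun fct_sumE.
have dfd i v : derivable (f i) z v by exact: diff_derivable.
apply/rowP => j; rewrite mxE deriveZ; last by apply: derivable_sum => i.
rewrite derive_sum// mxE summxE; congr (_ * _).
by apply: eq_bigr => i _; rewrite mxE.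
Qed.

(** The entries of [tkappa3] are the ratios at which these margins vanish, and their denominators
    are positive. *)
Lemma step_size_bounds {R : realType} (alpha beta eta Lf rho rho2 : R) :
  0 < alpha -> 0 < beta -> 0 < Lf -> 0 <= rho -> 0 < rho2 ->
  0 < eta < tkappa3 alpha beta Lf rho rho2 ->
  [/\ 0 < eps1 alpha beta Lf rho2 - eta * teps2 alpha beta Lf rho,
      0 < eps3 beta rho2 - eta * teps4 beta rho rho2 &
      0 < eps5 alpha beta Lf rho2 - eta * eps6 alpha beta Lf rho2].
Proof.
move=> a0 b0 Lf0 rho0 r20; rewrite /tkappa3 !lt_min => /andP[e0 /and3P[h1 h3 h5]].
have Lf2 : 0 < Lf ^+ 2 by rewrite exprn_gt0.
have t2 : 0 < teps2 alpha beta Lf rho.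
  rewrite /teps2 ltr_wpDr//; last by rewrite !addr_gt0 ?mulr_gt0 ?exprn_gt0.
  by rewrite -mulrA mulr_ge0// -exprMn sqr_ge0.
have t4 : 0 < teps4 beta rho rho2.
  by rewrite /teps4 ltr_wpDl ?invr_gt0// mulr_ge0// mulr_ge0// sqr_ge0.
have t6 : 0 < eps6 alpha beta Lf rho2.
  by rewrite /eps6 !addr_gt0 ?divr_gt0 ?mulr_gt0 ?exprn_gt0 ?addr_gt0.
by split; rewrite subr_gt0 -ltr_pdivlMr.
Qed.

Theorem theorem6 (R : realType) (n d : nat) (A : 'M[R]_n)
    (f : 'I_n -> 'rV[R]_d -> R) (Lf nu fstar : R)
    (dT dO : measure_display)
    (T : measurableType dT) (PT : probability T R)
    (Q : T -> 'rV[R]_d -> 'rV[R]_d) (p C : R)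
    (Omega : measurableType dO) (P : probability Omega R)
    (xi : nat * 'I_n -> Omega -> T)
    (kappa1 kappa4 alpha beta eta s0 gamma teps : R)
    (x0 : 'I_n -> 'rV[R]_d)
    (x xhat y v q : Omega -> nat -> 'I_n -> 'rV[R]_d) :
  let L := laplacian A in
  let rho := spectral_radius L in
  let rho2 := smallest_pos_eigenvalue L in
  let favg := fun z : 'rV[R]_d => n%:R^-1 * \sum_(i < n) f i z in
  let xbar := fun (w : Omega) (k : nat) => mean (x w k) in
  (2 <= n)%N ->
  weighted_adjacency A ->
  connected_graph A ->
  0 < Lf ->
  (forall i z, differentiable (f i) z) ->
  (forall i z z', norm2 (gradient (f i) z - gradient (f i) z')
                  <= Lf * norm2 (z - z')) ->
  (exists z, favg z = fstar) ->
  (forall z, fstar <= favg z) ->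
  0 < nu ->
  (forall z, nu * (favg z - fstar) <= 2^-1 * norm2 (gradient favg z) ^+ 2) ->
  1 <= p ->
  0 <= C ->
  compressor_measurable Q ->
  compression_error_bounded PT Q p C ->
  fresh_seeds PT P xi ->
  0 < kappa4 ->
  Num.max ((9 + kappa4) / (2 * rho2)) 1 <= kappa1 ->
  alpha = kappa1 * beta ->
  kappa2 kappa1 kappa4 Lf rho2 < beta ->
  0 < eta < tkappa3 alpha beta Lf rho rho2 ->
  0 < s0 ->
  0 < gamma < 1 ->
  (forall w, compressed_primal_dual L (fun i => gradient (f i)) alpha beta eta
     (fun k => s0 * gamma ^+ k) (fun k i => Q (xi (k, i) w)) x0
     (x w) (xhat w) (y w) (v w) (q w)) ->
  0 < teps < Num.min (teps0 alpha beta eta nu Lf rho rho2) (1 - gamma ^+ 2) ->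
  0 < teps < 1 /\
  exists M : R, forall k : nat,
    (\sum_(i < n)
       'E_P[(fun w => norm2 (x w k i - xbar w k) ^+ 2
                      + favg (xbar w k) - fstar)%R]
     <= (M * (1 - teps) ^+ k)%:E)%E.
Proof.
move=> L rho rho2 favg xbar n2 Awt Aconn Lf0 df Lip [zs zsE] fmin nu0 PL p1 C0 mQ QC seeds
  k40 k1le alphaE betagt eta_lt s00 /andP[g0 g1] traj /andP[t0 tlt].
have n0 : (0 < n)%N := ltnW n2.
have nR : 0 < n%:R :> R by rewrite ltr0n.
have r20 : 0 < rho2 := laplacian_rho2_gt0 Awt Aconn n2.
have rho0 : 0 <= rho := laplacian_rho_ge0 Awt Aconn n2.
have g2 : 0 < gamma ^+ 2 by rewrite exprn_gt0.
move: tlt; rewrite lt_min => /andP[tlt tg].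
have t1 : teps < 1 by apply: lt_le_trans tg _; rewrite gerBl ltW.
split; first by rewrite t0.
move: k1le; rewrite ge_max => /andP[k1r k11].
have b0 : 0 < beta.
  apply: lt_trans betagt; rewrite /kappa2 lt_max; apply/orP; left.
  by rewrite /kappa5 lt_max; apply/orP; right; rewrite divr_gt0.
have ba : beta <= alpha by rewrite alphaE ler_peMl// ltW.
have a0 : 0 < alpha by exact: lt_le_trans ba.
have abE : alpha / beta = kappa1 by rewrite alphaE mulfK// gt_eqF.
(* The bound on kappa1 gives kappa1 rho2 >= 9/2. *)
have c4 : 4 <= (1 + alpha / beta) * rho2.
  rewrite abE; move: k1r; rewrite ler_pdivrMr ?mulr_gt0// => k1r.
  move: r20 k40 k1r; clear; move=> r20 k40 k1r; lra.
have [e1 e3 e5] := step_size_bounds a0 b0 Lf0 rho0 r20 eta_lt.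
have /andP[eta0 _] := eta_lt.
have [Qi QP] := laplacian_pinv Awt Aconn n0.
have gapE z : gap f fstar z = n%:R * (favg z - fstar).
  by rewrite /gap /favg mulrBr mulrA divff ?mul1r// gt_eqF.
have gap0 z : 0 <= gap f fstar z by rewrite gapE mulr_ge0 ?subr_ge0// ltW.
have PL' z : 2 * nu * gap f fstar z <=
    n%:R * ip (mx_mean (grad_mx f ((const_mx 1)^T *m z)))
              (mx_mean (grad_mx f ((const_mx 1)^T *m z))).
  have -> : mx_mean (grad_mx f ((const_mx 1)^T *m z)) = gradient favg z.
    rewrite gradient_mean//; congr (_ *: _); apply/rowP => j.
    rewrite ones_mulmxE summxE; apply: eq_bigr => i _.
    by rewrite mxE row_ones_mulmx.
  rewrite gapE -norm2_sqr mulrCA ler_pM2l//.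
  by rewrite -mulrA -ler_pdivlMl.
have [Ce Ce0 step] := lyap_step n2 Awt Aconn Lf0 df Lip gap0 nu0 PL' b0 ba c4 eta0
  e1 e3 e5 QP t0 t1 tlt.
pose e w k := stack (fun i => xhat w k i - x w k i).
pose V w k := lyap A f fstar alpha beta Qi (stack (x w k)) (stack (v w k)).
have uv w k : (const_mx 1 : 'rV[R]_n) *m stack (v w k) = 0.
  exact: (cpd_dual_mean (traj w) k (ones_laplacian Awt)).
have rec w k : V w k.+1 <= (1 - teps) * V w k + Ce * ip (e w k) (e w k).
  rewrite /V (cpd_stack_x (traj w)) (cpd_stack_v (traj w)).
  exact: (step (stack (x w k)) (stack (v w k)) (e w k) (uv w k)).
pose V0 := lyap A f fstar alpha beta Qi (stack x0) (stack (fun=> 0)).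
(* The initial point is deterministic, so the initial Lyapunov value is the same on every
   trajectory. *)
have V0E w : V w 0%N = V0.
  rewrite /V /V0; congr lyap; apply/row_matrixP => i; rewrite !rowK.
    exact: (cpd_x_init (traj w)).
  exact: (cpd_v_init (traj w)).
have r0 : 0 <= 1 - teps by rewrite subr_ge0 ltW.
(* The recursion is unrolled on each trajectory; expectations are taken only of the resulting finite
   sum of squared errors. *)
have Vle w k := geometric_recursion r0 (rec w) k.
pose B := s0 ^+ 2 * (d%:R * C).
(* The factor 8/3 inverts the lower bound 3/8 on V, the fraction bounds the accumulated errors
   through [geometric_convolution_le], and the outer n counts the agents. *)
exists (n%:R * (8 / 3 * (V0 + Ce * (n%:R * B) / (1 - teps - gamma ^+ 2)))) => k.
have V00 : 0 <= V0.
  have u0 : (const_mx 1 : 'rV[R]_n) *m (stack (fun=> 0) : 'M[R]_(n, d)) = 0.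
    rewrite (_ : stack _ = 0) ?mulmx0//.
    by apply/row_matrixP => i; rewrite rowK row0.
  apply: le_trans (lyap_ge f fstar n2 Awt Aconn b0 ba c4 QP (stack x0) u0).
  by rewrite addr_ge0// mulr_ge0 ?ip_ge0// divr_ge0.
have cgrad i j : continuous (fun z => gradient (f i) z 0 j).
  exact: (continuous_gradient_coord Lf0 (Lip i) (j := j)).
have mx k' i := cpd_x_measurable mQ seeds cgrad traj k' i.
have mxhat k' i := cpd_xhat_measurable mQ seeds cgrad traj k' i.
have meanE w : xbar w k = mx_mean (stack (x w k)).
  rewrite /xbar /mean /mx_mean; congr (_ *: _); apply/rowP => j.
  by rewrite ones_mulmxE summxE; apply: eq_bigr => i _; rewrite mxE.
have bound i : ('E_P[(fun w => norm2 (x w k i - xbar w k) ^+ 2 + favg (xbar w k) - fstar)%R]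
    <= (8 / 3 * (V0 + Ce * (n%:R * B) / (1 - teps - gamma ^+ 2)) * (1 - teps) ^+ k)%:E)%E.
  have F0 w : 0 <= norm2 (x w k i - xbar w k) ^+ 2 + favg (xbar w k) - fstar.
    by rewrite -addrA addr_ge0 ?sqr_ge0// subr_ge0.
  have mxbar : coord_measurable (fun w => xbar w k).
    by apply: coord_measurableZ; apply: coord_measurable_sum => i'; exact: mx.
  have mF : measurable_fun setT
      (fun w => norm2 (x w k i - xbar w k) ^+ 2 + favg (xbar w k) - fstar).
    apply: measurable_funB; last exact: measurable_cst.
    apply: measurable_funD.
      by apply: measurable_funX; apply: measurable_pnorm; exact: coord_measurableB.
    apply: measurable_funM; first exact: measurable_cst.
    apply: measurable_sum => i'.
    have cf : continuous (f i') by move=> z; exact: differentiable_continuous.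
    exact: (measurableT_comp (continuous_measurable_rV cf) (coord_measurable_rV mxbar)).
  (* One agent's deviation is a single row of the centred stack, and f(xbar) - f^* is at most n
     times itself. *)
  have FV w : norm2 (x w k i - xbar w k) ^+ 2 + favg (xbar w k) - fstar <= 8 / 3 * V w k.
    have := lyap_ge f fstar n2 Awt Aconn b0 ba c4 QP (stack (x w k)) (uv w k).
    have : norm2 (x w k i - xbar w k) ^+ 2 <=
        ip (centering *m stack (x w k)) (centering *m stack (x w k)).
      rewrite norm2_sqr meanE [leRHS]ip_rows (bigD1 i)//= centeringE.
      rewrite [in leRHS]raddfB/= rowK row_ones_mulmx lerDl.
      by apply: sumr_ge0 => i' _; exact: ip_ge0.
    have : favg (xbar w k) - fstar <= gap f fstar (xbar w k).
      by rewrite gapE ler_peMl ?subr_ge0// ler1n.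
    rewrite -meanE -/(V w k).
    move: (norm2 _ ^+ 2) (ip _ _) (gap _ _ _) (gap0 (xbar w k)).
    move: (V w k) (favg (xbar w k)); clear; intros; lra.
  pose r := 1 - teps.
  pose g (a : 'I_k * 'I_n) w := ip (xhat w a.1 a.2 - x w a.1 a.2) (xhat w a.1 a.2 - x w a.1 a.2).
  pose c (a : 'I_k * 'I_n) := 8 / 3 * (Ce * r ^+ (k.-1 - a.1)).
  pose b (a : 'I_k * 'I_n) := (s0 * gamma ^+ a.1) ^+ 2 * (d%:R * C).
  (* The condition teps < 1 - gamma^2: the squared scaling decays faster than the target rate. *)
  have rgt : gamma ^+ 2 < r by rewrite /r ltrBrDl -ltrBrDr.
  have FVg w : norm2 (x w k i - xbar w k) ^+ 2 + favg (xbar w k) - fstar <=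
      8 / 3 * (r ^+ k * V0) + \sum_a c a * g a w.
    apply: le_trans (FV w) _.
    have -> : \sum_a c a * g a w = 8 / 3 * \sum_(j < k) Ce * r ^+ (k.-1 - j) * ip (e w j) (e w j).
      transitivity (\sum_(j < k) \sum_(i' < n) c (j, i') * g (j, i') w).
        by rewrite pair_bigA.
      rewrite mulr_sumr; apply: eq_bigr => j _; rewrite ip_rows !mulr_sumr.
      by apply: eq_bigr => i' _; rewrite /c /g /= rowK !mulrA.
    rewrite -mulrDr ler_wpM2l// -(V0E w); exact: Vle.
  have mg a : measurable_fun setT (g a).
    by apply: measurable_ip; apply: coord_measurableB.
  have gpos a w : 0 <= g a w by exact: ip_ge0.
  have apos : 0 <= 8 / 3 * (r ^+ k * V0) by rewrite mulr_ge0// mulr_ge0// exprn_ge0.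
  have cpos a : 0 <= c a by rewrite /c mulr_ge0// mulr_ge0// exprn_ge0.
  have gb a : (\int[P]_w (g a w)%:E <= (b a)%:E)%E.
    apply: (cpd_error_expectation p1 mQ QC seeds cgrad traj).
    by rewrite mulf_neq0 ?expf_neq0// gt_eqF.
  apply: le_trans (expectation_affine_le mF mg F0 gpos apos cpos FVg gb) _.
  rewrite lee_fin.
  have -> : \sum_a c a * b a =
      8 / 3 * (Ce * (n%:R * B)) * \sum_(j < k) r ^+ (k.-1 - j) * (gamma ^+ 2) ^+ j.
    transitivity (\sum_(j < k) \sum_(i' < n) c (j, i') * b (j, i')).
      by rewrite pair_bigA.
    rewrite mulr_sumr; apply: eq_bigr => j _.
    rewrite (eq_bigr (fun=> 8 / 3 * (Ce * r ^+ (k.-1 - j)) *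
      ((s0 * gamma ^+ j) ^+ 2 * (d%:R * C))))// sumr_const card_ord -mulr_natl /B exprMn -!exprM (mulnC j).
    by move: (r ^+ _) (gamma ^+ _) => rj gj; ring.
  have := geometric_convolution_le k (ltW g2) rgt => conv.
  have B0 : 0 <= 8 / 3 * (Ce * (n%:R * B)).
    by rewrite mulr_ge0// mulr_ge0// mulr_ge0 ?ler0n// /B mulr_ge0 ?sqr_ge0// mulr_ge0.
  apply: le_trans (lerD (lexx _) (ler_wpM2l B0 conv)) _.
  rewrite -/r le_eqVlt; apply/orP; left; apply/eqP.
  by move: (r ^+ k) ((r - gamma ^+ 2)^-1) => rk ri; ring.
apply: (@le_trans _ _ (\sum_(i < n) (8 / 3 * (V0 + Ce * (n%:R * B) / (1 - teps - gamma ^+ 2))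
     * (1 - teps) ^+ k)%:E)%E); first exact: lee_sum.
by rewrite sumEFin lee_fin sumr_const card_ord -[_ *+ n]mulr_natl !mulrA.
Qed.
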